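(* Let $\{X^{(i)}\}_{i=1}^m\subset\mathcal{H}_n$ be a finite sequence of independent random $n\times n$ Hermitian matrices, and let $Y=\sum_{i=1}^mX^{(i)}$. Then for any integer $1\leq k\leq n$, $$\sum_{i=1}^k\lambda_i(\mathbb{E}Y) \leq \mathbb{E}\sum_{i=1}^k\lambda_i(Y) \leq \inf_{\theta>0}\ \frac{1}{\theta}\ln \mathrm{Tr}_k\Big[\exp\Big(\sum_{i=1}^m\ln\mathbb{E}\exp(\theta X^{(i)})\Big)\Big],$$ $$\sum_{i=1}^k\lambda_{n-i+1}(\mathbb{E}Y) \geq \mathbb{E}\sum_{i=1}^k\lambda_{n-i+1}(Y) \geq \sup_{\theta<0}\ \frac{1}{\theta}\ln \mathrm{Tr}_k\Big[\exp\Big(\sum_{i=1}^m\ln\mathbb{E}\exp(\theta X^{(i)})\Big)\Big].$$ Furthermore, for all $t\in \mathbb{R}$, $$\mathbb{P}\Big\{\sum_{i=1}^k\lambda_i(Y) \geq t\Big\} \leq \inf_{\theta>0}\ e^{-\frac{\theta t}{k}}\Big(\mathrm{Tr}_k\Big[\exp\Big(\sum_{i=1}^m\ln\mathbb{E}\exp(\theta X^{(i)})\Big)\Big]\Big)^\frac{1}{k},$$ $$\mathbb{P}\Big\{\sum_{i=1}^k\lambda_{n-i+1}(Y) \leq t\Big\}\leq \inf_{\theta<0}\ e^{-\frac{\theta t}{k}}\Big(\mathrm{Tr}_k\Big[\exp\Big(\sum_{i=1}^m\ln\mathbb{E}\exp(\theta X^{(i)})\Big)\Big]\Big)^\frac{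1}{k}.$$
   Context: $\mathcal{H}_n$ is the space of $n\times n$ complex Hermitian matrices. For $A\in\mathcal{H}_n$, $\lambda_i(A)$ denotes the $i$-th largest eigenvalue of $A$ (counted with multiplicity), so $\lambda_{n-i+1}(A)$ is the $i$-th smallest. $\mathrm{Tr}_k[A]=\sum_{1\le i_1<\cdots<i_k\le n}\lambda_{i_1}\cdots\lambda_{i_k}$ is the $k$-th elementary symmetric polynomial of the eigenvalues $\lambda_1,\dots,\lambda_n$ of $A$. $\exp$ and $\ln$ of Hermitian (resp. positive definite) matrices are defined through the spectral decomposition. The expectation of a random matrix is taken entrywise. All expectations appearing in the statement (of $X^{(i)}$ and of $\exp(\theta X^{(i)})$ for real $\theta$) are understood to exist and be finite. *)

(* Defs.v *)
From mathcomp Require Import all_boot all_order all_algebra.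
From mathcomp Require Import complex.
From mathcomp Require Import all_classical all_reals all_analysis.

Set Implicit Arguments.
Unset Strict Implicit.
Unset Printing Implicit Defensive.

Import Order.TTheory GRing.Theory Num.Theory.

Local Open Scope classical_set_scope.
Local Open Scope ring_scope.
Local Open Scope complex_scope.

Section Spectrum.
Context {R : realType} {n : nat}.
Implicit Types A : 'M[R[i]]_n.

(* The definitions of this section are meant for Hermitian A. In that case
   A = invmx (spectralmx A) *m diag_mx (spectral_diag A) *m spectralmx A with
   spectralmx A unitary and spectral_diag A real, so that taking real parts
   loses nothing. *)

Definition eigvals A : seq R :=
  sort >=%R [seq complex.Re (spectral_diag A ord0 j) | j <- enum 'I_n].

(* Indices start at 1: lambda 1 A is the largest eigenvalue and lambda n A the
   smallest; the value is only meaningful for 1 <= j <= n. *)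
Definition lambda (j : nat) A : R := nth 0 (eigvals A) j.-1.

Definition specfun (f : R -> R) A : 'M[R[i]]_n :=
  invmx (spectralmx A)
  *m diag_mx (map_mx (fun z => (f (complex.Re z))%:C) (spectral_diag A))
  *m spectralmx A.

Definition expmx : 'M[R[i]]_n -> 'M[R[i]]_n := specfun expR.

Definition lnmx : 'M[R[i]]_n -> 'M[R[i]]_n := specfun (@ln R).

Definition Tr (k : nat) A : R :=
  \sum_(I : {set 'I_n} | #|I| == k) \prod_(j in I) lambda j.+1 A.

End Spectrum.

Section RandomMatrices.
Context {d : measure_display} {T : measurableType d} {R : realType} {n : nat}.
Variable P : probability T R.
Implicit Types X : T -> 'M[R[i]]_n.

(* The Borel sigma-algebra of the real vector space of complex n x n matrices,
   generated by the real and imaginary parts of the entries. *)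
Definition borel_mx : set (set 'M[R[i]]_n) :=
  <<s [set B | exists a b (U : set R), measurable U /\
        (B = [set A : 'M[R[i]]_n | U (complex.Re (A a b))] \/
         B = [set A : 'M[R[i]]_n | U (complex.Im (A a b))])] >>.

Definition random_mx X : Prop :=
  forall B, borel_mx B -> measurable (X @^-1` B).

Definition independent_mx (m : nat) (X : 'I_m -> T -> 'M[R[i]]_n) : Prop :=
  forall (J : {set 'I_m}) (B : 'I_m -> set 'M[R[i]]_n),
    (forall i, i \in J -> borel_mx (B i)) ->
    P (\bigcap_(i in [set i | i \in J]) (X i @^-1` B i)) =
    (\prod_(i in J) P (X i @^-1` B i))%E.

Definition integrable_mx X : Prop :=
  forall a b,
    P.-integrable setT (EFin \o (fun w => complex.Re (X w a b))) /\
    P.-integrable setT (EFin \o (fun w => complex.Im (X w a b))).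

(* The entrywise expectation; meaningful when integrable_mx X holds. *)
Definition expectation_mx X : 'M[R[i]]_n :=
  \matrix_(a, b)
    (fine 'E_P[fun w => complex.Re (X w a b)]
     +i* fine 'E_P[fun w => complex.Im (X w a b)]).

End RandomMatrices.

(* Main.v *)
(** By the Laplace transform method it suffices to majorize
    exp (sum_(i <= k) lambda_i (theta Y) / k) by a random variable G with
    E G <= Tr_k (M) ^ (1/k), where M = exp (sum_i ln E exp (theta X_i)).
    The function e_k ^ (1/k) is concave (Marcus and Lopes), hence supported at
    the eigenvalues of M by a linear form sum_i c_i x_i. If L has the
    eigenvalues ln c_i in an eigenbasis of M, then
    Tr_k (exp K) ^ (1/k) <= tr exp (K + L) for every Hermitian K, by Ky Fan
    majorization, with equality at K = ln M. So G = tr exp (theta Y + L) works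
    as soon as E tr exp (theta Y + L) <= tr exp (ln M + L): the k-trace is gone,
    and this is Lieb's concavity of A |-> tr exp (H + ln A), iterated over the
    independent summands.
    Lieb's theorem follows, by Gibbs' variational principle, from the joint
    convexity of the relative entropy tr T (ln T - ln A). For the latter ln is
    bounded below and above by Riemann sums, each term of which gives a quadratic
    form of T - A with respect to the inverse of an operator that is linear in
    T and A; such forms are suprema of linear functions of (T, A). *)

From mathcomp Require Import all_boot all_order perm all_algebra.
From mathcomp Require Import ring lra zify.
Import Order.TTheory GRing.Theory Num.Theory.
Local Open Scope ring_scope.

(** * Elementary symmetric polynomials *)

(** The concavity of A |-> Tr_k [exp (H + ln A)] ^ (1/k) is not established here. Only one point
    matters, the matrix M, which is deterministic; so are the hyperplane and L, which can therefore
    be absorbed into the fixed matrix H of Lieb's theorem, and the trace case is enough. The price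
    is that each c_i must be strictly positive for ln c_i to make sense, whence the positive
    coefficients in the supporting forms below. The root 1/k is there because e_k is homogeneous of
    degree k: its root has degree one, so that its supporting hyperplanes are linear forms without
    constant term. The Riemann sums are those of ln t - ln a = int_0^1 (t - a) / ((1 - u) t + u a)
    du. They avoid matrix-valued integrals but make the supporting form of the relative entropy
    exact only up to an arbitrary e > 0, which disappears after integration. Negative theta reduces
    to the largest eigenvalues of - Y. *)

Definition elsym {R : comNzRingType} {I : finType} (S : {set I}) (k : nat)
    (x : I -> R) : R :=
  \sum_(J : {set I} | (J \subset S) && (#|J| == k)) \prod_(j in J) x j.

Section ElementarySymmetric.
Variables (R : realFieldType) (I : finType).
Implicit Types (S J : {set I}) (x mu : I -> R).

Lemma elsym0 S x : elsym S 0 x = 1.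
Proof.
rewrite /elsym (big_pred1 set0) ?big_set0// => J.
rewrite cards_eq0; apply/andP/eqP => [[_ /eqP//]|->].
by rewrite sub0set.
Qed.

(** Removing [i] is a bijection from the sets through [i] to the subsets of [S :\ i]. The ground set
    [S] is a parameter so that the recursions can delete a variable. *)
Lemma elsym_mem S k x i : i \in S ->
  \sum_(J : {set I} | (J \subset S) && (#|J| == k.+1) && (i \in J)) \prod_(j in J) x j =
  x i * elsym (S :\ i) k x.
Proof.
move=> iS; rewrite big_distrr/= (reindex_onto (fun J => i |: J) (fun J => J :\ i)) /=; last first.
  by move=> J /andP[_ iJ]; rewrite setD1K.
apply: eq_big => [J|J].
  rewrite setU11 andbT subUset sub1set iS /= subsetD1.
  have [iJ|iJ] := boolP (i \in J) => /=.
    rewrite andbF andFb; apply/negbTE/negP => /andP[_ /eqP] /setP/(_ i).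
    by rewrite !inE eqxx iJ.
  by rewrite setU1K// eqxx andbT cardsU1 iJ add1n eqSS andbT.
move=> /andP[_ /eqP Ji]; rewrite big_setU1//=.
by move/setP: Ji => /(_ i); rewrite !inE eqxx /= => <-.
Qed.

Lemma elsymS S k x i : i \in S ->
  elsym S k.+1 x = x i * elsym (S :\ i) k x + elsym (S :\ i) k.+1 x.
Proof.
move=> iS; rewrite -elsym_mem// {1}/elsym (bigID (fun J : {set I} => i \in J)) /=.
congr (_ + _); apply: eq_bigl => J.
by rewrite subsetD1; case: (i \in J); rewrite ?andbF ?andbT.
Qed.

(** Double counting of the pairs (J, i) with i in J; this is Euler's identity for a homogeneous
    polynomial of degree k + 1. *)
Lemma elsym_sum S k x :
  k.+1%:R * elsym S k.+1 x = \sum_(i in S) x i * elsym (S :\ i) k x.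
Proof.
transitivity (\sum_(i in S) \sum_(J : {set I} | (J \subset S) && (#|J| == k.+1) && (i \in J))
    \prod_(j in J) x j).
  rewrite (exchange_big_dep (fun J : {set I} => (J \subset S) && (#|J| == k.+1))) /=; last first.
    by move=> i J _ /andP[].
  rewrite /elsym big_distrr/=; apply: eq_bigr => J /andP[JS /eqP cJ].
  rewrite [RHS](eq_bigl (mem J)) => [|i]; last first.
    by rewrite JS cJ eqxx /= andb_idl// => /(subsetP JS).
  by rewrite sumr_const cJ mulr_natl.
by apply: eq_bigr => i; exact: elsym_mem.
Qed.

Lemma elsym_gt0 S k x : (forall i, 0 < x i) -> (k <= #|S|)%N -> 0 < elsym S k x.
Proof.
move=> x0; elim: k S => [|k IH] S kS; first by rewrite elsym0.
have : 0 < k.+1%:R * elsym S k.+1 x.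
  have /set0Pn[i iS] : S != set0 by rewrite -card_gt0 (leq_trans _ kS).
  rewrite elsym_sum (bigD1 i)//= ltr_pwDl//.
    by rewrite mulr_gt0// IH//; move: kS; rewrite (cardsD1 i) iS.
  apply: sumr_ge0 => j /andP[jS _]; rewrite mulr_ge0//; first exact/ltW.
  by apply/ltW/IH; move: kS; rewrite (cardsD1 j) jS.
by rewrite pmulr_rgt0.
Qed.

Definition elsym_ratio S k x := elsym S k.+1 x / elsym S k x.

Lemma elsym_ratio_gt0 S k x : (forall i, 0 < x i) -> (k < #|S|)%N -> 0 < elsym_ratio S k x.
Proof. by move=> x0 kS; rewrite divr_gt0// elsym_gt0// ltnW. Qed.

(** A telescoping product. It shows the k-th root of [elsym S k] to be a geometric mean of functions
    that are concave and homogeneous of degree one. *)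
Lemma elsym_prod_ratio S k x : (forall i, 0 < x i) -> (k <= #|S|)%N ->
  elsym S k x = \prod_(j < k) elsym_ratio S j x.
Proof.
move=> x0; elim: k => [|k IH] kS; first by rewrite elsym0 big_ord0.
rewrite big_ord_recr/= -IH 1?ltnW// /elsym_ratio mulrC divfK//.
by rewrite gt_eqF// elsym_gt0// ltnW.
Qed.

(* Marcus and Lopes: the ratio is an average of parallel sums, which are
   concave. *)
Lemma elsym_ratioS S k x : (forall i, 0 < x i) -> (k.+1 < #|S|)%N ->
  elsym_ratio S k.+1 x = k.+2%:R^-1 *
    \sum_(i in S) x i * elsym_ratio (S :\ i) k x / (x i + elsym_ratio (S :\ i) k x).
Proof.
move=> x0 kS; have kn0 : k.+2%:R != 0 :> R by rewrite pnatr_eq0.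
apply: (mulfI kn0); rewrite mulVKf// {1}/elsym_ratio mulrA elsym_sum mulr_suml.
apply: eq_bigr => i iS.
have kSi : (k < #|S :\ i|)%N by move: kS; rewrite (cardsD1 i) iS.
have e0 : elsym (S :\ i) k x != 0 by rewrite gt_eqF// elsym_gt0// ltnW.
have e1 := elsym_gt0 S k.+1 x x0 (ltnW kS).
rewrite (elsymS S k x i iS) /elsym_ratio; field; rewrite e0 /=.
by rewrite -elsymS// gt_eqF.
Qed.

(** The parallel sum is the minimum over [t] of the right-hand side, attained at t = b / (a + b).
    For fixed [t] the bound is linear in (a, b), hence a supporting form. *)
Lemma parallel_le (a b t : R) : 0 < a -> 0 < b ->
  a * b / (a + b) <= t ^+ 2 * a + (1 - t) ^+ 2 * b.
Proof.
move=> a0 b0; rewrite ler_pdivrMr ?addr_gt0// -subr_ge0.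
have -> : (t ^+ 2 * a + (1 - t) ^+ 2 * b) * (a + b) - a * b
   = (t * a - (1 - t) * b) ^+ 2 by ring.
exact: sqr_ge0.
Qed.

(** Each parallel sum of [elsym_ratioS] is bounded by its tangent at [mu], and the ratio over
    [S :\ i] inside it by the form given by induction, which is allowed because its factor (1 - t)^2
    is nonnegative. Strict positivity of the coefficients comes from the term t^2. *)
Lemma elsym_ratio_support S k mu : (forall i, 0 < mu i) -> (k < #|S|)%N ->
  exists2 a : I -> R, (forall i, i \in S -> 0 < a i) &
    elsym_ratio S k mu = \sum_(i in S) a i * mu i /\
    forall x, (forall i, 0 < x i) -> elsym_ratio S k x <= \sum_(i in S) a i * x i.
Proof.
move=> mu0; elim: k S => [|k IH] S kS.
  exists (fun => 1) => //.
  have E x : elsym_ratio S 0 x = \sum_(i in S) 1 * x i.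
    rewrite /elsym_ratio elsym0 divr1 -[LHS](mul1r (elsym S 1 x)) -[1 * _]/(0.+1%:R * _) elsym_sum.
    by apply: eq_bigr => i _; rewrite elsym0 mulrC.
  by rewrite E; split=> // x _; rewrite E.
have kSi i : i \in S -> (k < #|S :\ i|)%N by move=> iS; move: kS; rewrite (cardsD1 i) iS.
have {IH} /fin_all_exists2[a a0 aP] : forall i, exists2 a : I -> R,
    i \in S -> forall j, j \in S :\ i -> 0 < a j &
    i \in S -> elsym_ratio (S :\ i) k mu = \sum_(j in S :\ i) a j * mu j /\
    forall x, (forall j, 0 < x j) ->
      elsym_ratio (S :\ i) k x <= \sum_(j in S :\ i) a j * x j.
  move=> i; have [iS|] := boolP (i \in S); last by exists (fun => 0).
  by have [a] := IH _ (kSi _ iS); exists a.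
pose q i := elsym_ratio (S :\ i) k mu.
have q0 i : i \in S -> 0 < q i by move=> iS; apply: elsym_ratio_gt0 => //; exact: kSi.
(* The parameter for which [parallel_le] is an equality at [mu]. *)
pose t i := q i / (mu i + q i).
have E x : \sum_(i in S) (t i ^+ 2 * x i + (1 - t i) ^+ 2 * \sum_(j in S :\ i) a i j * x j) =
    \sum_(j in S) (t j ^+ 2 + \sum_(i in S :\ j) (1 - t i) ^+ 2 * a i j) * x j.
  rewrite big_split/= [RHS](eq_bigr _ (fun j _ => mulrDl _ _ _)) big_split/=; congr (_ + _).
  under eq_bigr do rewrite big_distrr/=.
  rewrite (exchange_big_dep (mem S)) /=; last by move=> i j iS; rewrite !inE => /andP[].
  apply: eq_bigr => j jS; rewrite mulr_suml; apply: eq_big => [i|i _].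
    by rewrite !inE jS andbT andbC eq_sym.
  by rewrite mulrA.
exists (fun j => k.+2%:R^-1 * (t j ^+ 2 + \sum_(i in S :\ j) (1 - t i) ^+ 2 * a i j)).
  move=> j jS; rewrite mulr_gt0 ?invr_gt0 ?ltr0n// ltr_pwDl//.
    by rewrite exprn_gt0// divr_gt0 ?addr_gt0// q0.
  apply: sumr_ge0 => i; rewrite !inE => /andP[ij iS]; rewrite mulr_ge0 ?sqr_ge0//.
  by apply/ltW/(a0 i iS); rewrite !inE eq_sym ij.
split=> [|x x0].
  under [RHS]eq_bigr do rewrite -mulrA.
  rewrite -big_distrr/= -E elsym_ratioS//; congr (_ * _); apply: eq_bigr => i iS.
  rewrite -(aP i iS).1 -/(q i) /t.
  have m := addr_gt0 (mu0 i) (q0 i iS); field; exact: lt0r_neq0.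
under eq_bigr do rewrite -mulrA.
rewrite -big_distrr/= -E elsym_ratioS// ler_pM2l ?invr_gt0 ?ltr0n//.
apply: ler_sum => i iS; apply: le_trans (parallel_le _ _ (t i) (x0 i) _) _.
  by apply: elsym_ratio_gt0 => //; exact: kSi.
by rewrite lerD2l ler_wpM2l ?sqr_ge0//; exact: (aP i iS).2.
Qed.

(** By the arithmetic-geometric mean inequality, the product of the k normalized ratios q_j(x) /
    q_j(mu) is at most the k-th power of their mean, and each has a supporting form. At [mu] all of
    them equal 1. Taking k-th powers avoids roots. *)
Lemma elsym_support S k mu : (forall i, 0 < mu i) -> (0 < k <= #|S|)%N ->
  exists2 a : I -> R, (forall i, i \in S -> 0 < a i) &
    \sum_(i in S) a i * mu i = 1 /\
    forall x, (forall i, 0 < x i) ->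
      elsym S k x <= elsym S k mu * (\sum_(i in S) a i * x i) ^+ k.
Proof.
move=> mu0 /andP[k0 kS].
have jS (j : 'I_k) : (j < #|S|)%N := leq_trans (ltn_ord j) kS.
have /fin_all_exists2[a a0 aP] := fun j : 'I_k => elsym_ratio_support S j mu mu0 (jS j).
pose q (j : 'I_k) := elsym_ratio S j mu.
have q0 j : 0 < q j by exact: elsym_ratio_gt0.
have E x : \sum_(i in S) (k%:R^-1 * \sum_j a j i / q j) * x i =
    (\sum_j (\sum_(i in S) a j i * x i) / q j) / k%:R.
  under eq_bigr do rewrite mulrC mulrCA mulrC; rewrite -mulr_suml; congr (_ / _).
  under eq_bigr do rewrite mulr_sumr.
  rewrite exchange_big /=; apply: eq_bigr => j _; rewrite mulr_suml.
  by apply: eq_bigr => i _; rewrite mulrCA mulrA.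
exists (fun i => k%:R^-1 * \sum_j a j i / q j).
  move=> i iS; rewrite mulr_gt0 ?invr_gt0 ?ltr0n//.
  rewrite (bigD1 (Ordinal k0))//= ltr_pwDl//; first exact: divr_gt0 (a0 _ _ iS) (q0 _).
  by apply: sumr_ge0 => j _; apply: divr_ge0; apply: ltW; [exact: a0|exact: q0].
rewrite E; split=> [|x x0].
  have -> : \sum_j (\sum_(i in S) a j i * mu i) / q j = \sum_(j < k) 1.
    by apply: eq_bigr => j _; rewrite -(aP j).1 divff// gt_eqF//; exact: q0.
  by rewrite sumr_const card_ord divff// pnatr_eq0 -lt0n.
rewrite E mulrC -ler_pdivrMr ?elsym_gt0// !elsym_prod_ratio// -prodf_div.
have qx0 (j : 'I_k) : 0 < elsym_ratio S j x / q j by rewrite divr_gt0// elsym_ratio_gt0.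
have := @leif_AGM _ _ predT (fun j : 'I_k => elsym_ratio S j x / q j) (fun j _ => ltW (qx0 j)).
rewrite card_ord => /leif_le-H; apply: le_trans H _.
rewrite lerXn2r// ?nnegrE.
- by rewrite divr_ge0// sumr_ge0// => j _; rewrite ltW.
- rewrite divr_ge0// sumr_ge0// => j _; rewrite divr_ge0 ?(ltW (q0 j))//.
  by apply: sumr_ge0 => i iS; rewrite mulr_ge0 ?ltW//; exact: a0.
rewrite ler_pM2r ?invr_gt0 ?ltr0n//; apply: ler_sum => j _.
by rewrite ler_pM2r ?invr_gt0; [exact: (aP j).2|exact: q0].
Qed.

End ElementarySymmetric.

Require Import Defs.
From mathcomp Require Import complex.
From mathcomp Require Import all_classical all_reals all_analysis measurable_realfun.
Import Order.TTheory GRing.Theory Num.Theory.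
Local Open Scope ring_scope.

(** * Schur convexity *)

(** Abel summation. Keeping the total of [u] on the left, instead of assuming it zero, lets the
    induction go through without a sign condition on [g]. *)
Lemma abel_sum_ge (R : realFieldType) (n : nat) (u g : nat -> R) :
  (forall r, (r <= n.+1)%N -> 0 <= \sum_(i < r) u i) ->
  (forall i, (i < n)%N -> g i.+1 <= g i) ->
  (\sum_(i < n.+1) u i) * g n <= \sum_(i < n.+1) u i * g i.
Proof.
elim: n => [|n IH] u0 gE; first by rewrite !big_ord_recr !big_ord0/= !add0r.
rewrite big_ord_recr [leRHS]big_ord_recr/= mulrDl lerD2r.
apply: le_trans (IH _ _) => [|r rn|i ni]; last by rewrite gE// ltnW.
  by rewrite ler_wpM2l ?gE// u0.
by rewrite u0// ltnW.
Qed.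

(** The bathtub principle. Both sides have total weight [r], so subtracting [a r.-1] from every
    [a j] costs nothing; then the terms with j < r are nonnegative and the others nonpositive. *)
Lemma sum_weight_le (R : realFieldType) (n r : nat) (a : nat -> R) (p : 'I_n -> R) :
  (forall i j, (i <= j < n)%N -> a j <= a i) -> (r <= n)%N ->
  (forall j, 0 <= p j <= 1) -> \sum_j p j = r%:R ->
  \sum_j p j * a j <= \sum_(j < r) a j.
Proof.
move=> amon rn p01 pr; rewrite (big_ord_widen n a rn).
suff : \sum_j p j * (a j - a r.-1) <= \sum_(j < n | (j < r)%N) (a j - a r.-1).
  under eq_bigr do rewrite mulrBr.
  rewrite !sumrB -mulr_suml pr sumr_const.
  have -> : #|[pred j : 'I_n | (j < r)%N]| = r.
    by rewrite -sum1_card -(big_ord_widen n (fun=> 1%N) rn) sum1_card card_ord.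
  by rewrite mulr_natl lerD2r.
rewrite [leRHS]big_mkcond; apply: ler_sum => j _; have /andP[p0 p1] := p01 j.
case: ifP => jr.
  rewrite ler_piMl// subr_ge0 amon//; case: r jr {pr} rn => //= r jr rn.
  by rewrite -ltnS jr.
rewrite mulr_ge0_le0// subr_le0 amon// ltn_ord andbT.
by rewrite (leq_trans (leq_pred _))// leqNgt jr.
Qed.

Section SchurConvexity.
Variable R : realType.

(** The gradient inequality of a convex function: e_(k+1) o exp is a sum of exponentials of linear
    forms, and the factor of y_i - x_i is its i-th partial derivative at [x]. *)
Lemma elsym_exp_grad n k (x y : 'I_n -> R) :
  \sum_i (y i - x i) * (expR (x i) * elsym ([set: 'I_n] :\ i) k (expR \o x)) <=
  elsym [set: 'I_n] k.+1 (expR \o y) - elsym [set: 'I_n] k.+1 (expR \o x).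
Proof.
under eq_bigr do rewrite -(elsym_mem _ _ [set: 'I_n] k (expR \o x)) ?inE// big_distrr/=.
rewrite (exchange_big_dep (fun J : {set 'I_n} => (J \subset [set: 'I_n]) && (#|J| == k.+1))) /=;
  last by move=> i J _ /andP[].
rewrite /elsym -sumrB; apply: ler_sum => J JP; rewrite /= -!expR_sum.
rewrite (eq_bigl (mem J)) => [|i]; last by rewrite JP.
rewrite -mulr_suml sumrB.
set s := \sum_(i in J) x i; set v := \sum_(i in J) y i.
by rewrite -[v in X in _ <= X](subrK s) expRD -[X in _ <= _ - X]mul1r -mulrBl ler_pM2r ?expR_gt0// lerBrDl expR_ge1Dx.
Qed.

(** The Schur-Ostrowski condition. Once each side is expanded in the other variable, the terms
    containing both variables coincide. *)
Lemma elsym_exp_grad_mono n k (x : 'I_n -> R) (i j : 'I_n) : x j <= x i ->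
  expR (x j) * elsym ([set: 'I_n] :\ j) k (expR \o x) <=
  expR (x i) * elsym ([set: 'I_n] :\ i) k (expR \o x).
Proof.
have [<-//|ij] := eqVneq i j; move=> xij; have X : expR (x j) <= expR (x i) by rewrite ler_expR.
case: k => [|k]; first by rewrite !elsym0 !mulr1.
rewrite (elsymS _ _ ([set: 'I_n] :\ j) k _ i) ?inE ?ij//.
rewrite (elsymS _ _ ([set: 'I_n] :\ i) k _ j) ?inE 1?eq_sym ?ij//=.
have -> : ([set: 'I_n] :\ j) :\ i = ([set: 'I_n] :\ i) :\ j by apply/setP => l; rewrite !inE andbCA.
set S := _ :\ j; rewrite !mulrDr mulrCA lerD2l ler_wpM2r//.
by apply: sumr_ge0 => J _; apply: prodr_ge0 => l _; exact: expR_ge0.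
Qed.

(** Convexity makes the gradient at the sorted end [x] sufficient: its entries decrease, so Abel
    summation applies to the partial sums of y - x, whose total is zero. No order is required of
    [y]. *)
Lemma elsym_exp_majorize n k (x y : nat -> R) :
  (forall i j, (i <= j < n)%N -> x j <= x i) ->
  (forall r, (r <= n)%N -> \sum_(i < r) x i <= \sum_(i < r) y i) ->
  \sum_(i < n) x i = \sum_(i < n) y i ->
  elsym [set: 'I_n] k (fun i => expR (x i)) <= elsym [set: 'I_n] k (fun i => expR (y i)).
Proof.
move=> xmon xy xyn; case: k => [|k]; first by rewrite !elsym0.
rewrite -subr_ge0; apply: le_trans (elsym_exp_grad n k (fun i => x i) (fun i => y i)).
case: n xmon xy xyn => [|n] xmon xy xyn; first by rewrite big_ord0.
pose g (i : 'I_n.+1) :=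
  expR (x i) * elsym ([set: 'I_n.+1] :\ i) k (expR \o (fun i : 'I_n.+1 => x i)).
have := @abel_sum_ge R n (fun i => y i - x i) (fun i => g (inord i)).
rewrite [X in X * _ <= _]sumrB xyn subrr mul0r => H.
under eq_bigr do rewrite -/(g _).
rewrite (eq_bigr (fun i : 'I_n.+1 => (y i - x i) * g (inord i))); last first.
  by move=> i _; rewrite inord_val.
apply: H => [r rn|i ni]; first by rewrite sumrB subr_ge0 xy.
by apply: elsym_exp_grad_mono; rewrite !inordK ?xmon ?leqnSn// ltnS ltnW.
Qed.

End SchurConvexity.

Local Open Scope complex_scope.
Local Open Scope sesquilinear_scope.

(** * Hermitian matrices and their spectra *)

Section Complex.
Context {R : realType}.
Implicit Types z : R[i].

Lemma ReD z1 z2 : complex.Re (z1 + z2) = complex.Re z1 + complex.Re z2.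
Proof. by case: z1; case: z2. Qed.

Lemma ReN z : complex.Re (- z) = - complex.Re z. Proof. by case: z. Qed.

Lemma ReZ (a : R) z : complex.Re (a%:C * z) = a * complex.Re z.
Proof. by case: z => x y /=; rewrite mul0r subr0. Qed.

Lemma Re_sum (J : Type) (r : seq J) (p : pred J) (F : J -> R[i]) :
  complex.Re (\sum_(j <- r | p j) F j) = \sum_(j <- r | p j) complex.Re (F j).
Proof. by elim/big_rec2: _ => // j x y _ <-; rewrite ReD. Qed.

Lemma ImD z1 z2 : complex.Im (z1 + z2) = complex.Im z1 + complex.Im z2.
Proof. by case: z1; case: z2. Qed.

Lemma Im_sum (J : Type) (r : seq J) (p : pred J) (F : J -> R[i]) :
  complex.Im (\sum_(j <- r | p j) F j) = \sum_(j <- r | p j) complex.Im (F j).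
Proof. by elim/big_rec2: _ => // j x y _ <-; rewrite ImD. Qed.

Definition sqnorm z : R := complex.Re z ^+ 2 + complex.Im z ^+ 2.

Lemma mulcJ z : z * z^* = (sqnorm z)%:C.
Proof.
rewrite /sqnorm; case: z => x y.
by apply/eqP; rewrite eq_complex /=; apply/andP; split; apply/eqP; ring.
Qed.

Lemma mulJc z : z^* * z = (sqnorm z)%:C. Proof. by rewrite mulrC mulcJ. Qed.

Lemma sqnorm_ge0 z : 0 <= sqnorm z. Proof. by rewrite addr_ge0 ?sqr_ge0. Qed.

Lemma sqnormM (z1 z2 : R[i]) : sqnorm (z1 * z2) = sqnorm z1 * sqnorm z2.
Proof. by rewrite /sqnorm; case: z1 => a b; case: z2 => c e /=; ring. Qed.

Lemma sqnormJ z : sqnorm z^* = sqnorm z.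
Proof. by case: z => x y; rewrite /sqnorm /= sqrrN. Qed.

End Complex.

Section ClosedField.
Context {C : numClosedFieldType} {n : nat}.
Implicit Types (U V A B : 'M[C]_n) (a b : 'rV[C]_n).

Definition unitary_diag U a : 'M[C]_n := U^t* *m diag_mx a *m U.

Lemma unitaryKl {U} : U \is unitarymx -> U *m U^t* = 1%:M.
Proof. by move/unitarymxP. Qed.

Lemma unitaryKr {U} : U \is unitarymx -> U^t* *m U = 1%:M.
Proof. by move=> Uu; rewrite -invmx_unitary// mulVmx// unitarymx_unit. Qed.

Lemma unitary_diagE U a p q :
  unitary_diag U a p q = \sum_j a ord0 j * ((U j p)^* * U j q).
Proof.
rewrite mxE; apply: eq_bigr => j _; rewrite mul_mx_diag !mxE.
by rewrite mulrCA mulrA.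
Qed.

Lemma unitary_diag_conj U a : U \is unitarymx ->
  U *m unitary_diag U a *m U^t* = diag_mx a.
Proof.
move=> Uu; rewrite /unitary_diag !mulmxA unitaryKl// mul1mx -mulmxA.
by rewrite unitaryKl// mulmx1.
Qed.

Lemma unitary_diag_intertwine U V a b : U \is unitarymx -> V \is unitarymx ->
  (unitary_diag U a == unitary_diag V b) =
  (diag_mx a *m (U *m V^t*) == U *m V^t* *m diag_mx b).
Proof.
move=> Uu Vu; apply/eqP/eqP => ab.
  rewrite -(unitary_diag_conj V b Vu) -(unitary_diag_conj U a Uu) ab !mulmxA.
  rewrite -[_ *m U^t* *m U]mulmxA unitaryKr// mulmx1.
  by rewrite -[_ *m V^t* *m V]mulmxA unitaryKr// mulmx1.
transitivity (U^t* *m (diag_mx a *m (U *m V^t*)) *m V).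
  by rewrite /unitary_diag !mulmxA -[RHS]mulmxA unitaryKr// mulmx1.
by rewrite ab !mulmxA unitaryKr// mul1mx.
Qed.

(** The change of basis W intertwines the two diagonals: a_i W_ij = W_ij b_j. So W_ij can be nonzero
    only if a_i = b_j, and W also intertwines [a'] and [b']. This makes the functional calculus
    independent of the chosen diagonalization. *)
Lemma eq_unitary_diag U V a b a' b' : U \is unitarymx -> V \is unitarymx ->
  (forall i j, a ord0 i = b ord0 j -> a' ord0 i = b' ord0 j) ->
  unitary_diag U a = unitary_diag V b -> unitary_diag U a' = unitary_diag V b'.
Proof.
move=> Uu Vu ab /eqP; rewrite unitary_diag_intertwine// => /eqP MM.
apply/eqP; rewrite unitary_diag_intertwine//; apply/eqP.
move: (U *m _) MM => M MM; apply/matrixP => i j; have /matrixP/(_ i j) := MM.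
rewrite !mul_mx_diag !mul_diag_mx !mxE; have [->|M0] := eqVneq (M i j) 0.
  by rewrite !mul0r !mulr0.
by rewrite mulrC => /(mulfI M0)/ab ->; rewrite mulrC.
Qed.

Lemma unitary_mulmxtC U V : U \is unitarymx -> V \is unitarymx -> U *m V^t* \is unitarymx.
Proof. by move=> Uu Vu; rewrite mul_unitarymx// trmxC_unitary. Qed.

Lemma unitary_row_norm U i : U \is unitarymx -> \sum_j U i j * (U i j)^* = 1.
Proof.
move=> /unitaryKl /matrixP/(_ i i); rewrite !mxE eqxx mulr1n => <-.
by apply: eq_bigr => j _; rewrite !mxE.
Qed.

Lemma mulmxtC_adj U V : (U *m V^t*)^t* = V *m U^t*.
Proof. by rewrite trmx_mul map_mxM/= trmxCK. Qed.

Lemma char_poly_unitary_diag U a : U \is unitarymx ->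
  char_poly (unitary_diag U a) = \prod_j ('X - (a ord0 j)%:P).
Proof.
move=> Uu; have D : is_trig_mx (diag_mx a) by exact/is_diag_mx_is_trig/diag_mx_is_diag.
transitivity (char_poly (diag_mx a)); last first.
  by rewrite char_poly_trig//; apply: eq_bigr => j _; rewrite !mxE eqxx.
rewrite /char_poly /char_poly_mx /unitary_diag !map_mxM/=.
set P := map_mx _ (U^t*); set Q := map_mx _ U; set E := map_mx _ (diag_mx _).
have PQ : P *m Q = 1%:M by rewrite -map_mxM unitaryKr// map_mx1.
have -> : 'X%:M - P *m E *m Q = P *m ('X%:M - E) *m Q.
  by rewrite mulmxBr mulmxBl scalar_mxC -[_ *m P *m Q]mulmxA PQ mulmx1.
by rewrite !det_mulmx mulrAC -det_mulmx PQ det1 mul1r.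
Qed.

(** Both families list the roots of one characteristic polynomial with multiplicity. *)
Lemma unitary_diag_perm_eq U V a b : U \is unitarymx -> V \is unitarymx ->
  unitary_diag U a = unitary_diag V b -> perm_eq (codom (a ord0)) (codom (b ord0)).
Proof.
move=> Uu Vu /(congr1 char_poly); rewrite !char_poly_unitary_diag//.
rewrite -(big_map (a ord0) predT (fun z => 'X - z%:P)).
rewrite -(big_map (b ord0) predT (fun z => 'X - z%:P)) => /prod_XsubC_eq.
by rewrite /codom /image_mem !enumT.
Qed.

Lemma spectral_unitary_diag A : A \is hermsymmx ->
  A = unitary_diag (spectralmx A) (spectral_diag A).
Proof.
move=> /hermitian_normalmx /orthomx_spectralP {1}->.
by rewrite /unitary_diag invmx_unitary// spectral_unitarymx.
Qed.

Lemma row_perm_unitary (s : 'S_n) U : U \is unitarymx -> row_perm s U \is unitarymx.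
Proof.
move=> Uu; apply/unitarymxP/matrixP => i j.
have /matrixP/(_ (s i) (s j)) := unitaryKl Uu; rewrite !mxE (inj_eq perm_inj) => <-.
by apply: eq_bigr => l _; rewrite !mxE.
Qed.

Lemma unitary_diag_row_perm (s : 'S_n) U a :
  unitary_diag (row_perm s U) (col_perm s a) = unitary_diag U a.
Proof.
apply/matrixP => p q; rewrite !unitary_diagE [RHS](reindex_inj (@perm_inj _ s)).
by apply: eq_bigr => j _; rewrite !mxE.
Qed.

Lemma unitary_diagD U a b : unitary_diag U a + unitary_diag U b = unitary_diag U (a + b).
Proof.
apply/matrixP => p q; rewrite mxE !unitary_diagE -big_split.
by apply: eq_bigr => j _; rewrite [(a + b) _ _]mxE mulrDl.
Qed.

Lemma unitary_diagN U a : - unitary_diag U a = unitary_diag U (- a).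
Proof.
apply/matrixP => p q; rewrite mxE !unitary_diagE -sumrN; apply: eq_bigr => j _.
by rewrite [(- a) _ _]mxE mulNr.
Qed.

Lemma unitary_diagZ c U a : c *: unitary_diag U a = unitary_diag U (c *: a).
Proof.
apply/matrixP => p q; rewrite mxE !unitary_diagE mulr_sumr; apply: eq_bigr => j _.
by rewrite [(c *: a) _ _]mxE mulrA.
Qed.

Lemma unitary_diagM U a b : U \is unitarymx ->
  unitary_diag U a *m unitary_diag U b = unitary_diag U (\row_j (a ord0 j * b ord0 j)).
Proof.
move=> Uu; rewrite /unitary_diag !mulmxA -[_ *m U *m U^t*]mulmxA unitaryKl// mulmx1.
by rewrite -[_ *m diag_mx a *m _]mulmxA mulmx_diag.
Qed.

Lemma unitary_diag1 U : U \is unitarymx -> unitary_diag U (const_mx 1) = 1%:M.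
Proof. by move=> Uu; rewrite /unitary_diag diag_const_mx mulmx1 unitaryKr. Qed.

Lemma mxtrace_unitary_diag U a : U \is unitarymx ->
  \tr (unitary_diag U a) = \sum_j a ord0 j.
Proof.
by move=> Uu; rewrite mxtrace_mulC mulmxA unitaryKl// mul1mx mxtrace_diag.
Qed.

Lemma mxtrace_unitary_diagM U V a b :
  \tr (unitary_diag U a *m unitary_diag V b) =
  \sum_i \sum_j (a ord0 i * b ord0 j) * ((U *m V^t*) i j * ((U *m V^t*) i j)^*).
Proof.
rewrite /unitary_diag -!mulmxA mxtrace_mulC !mulmxA -[_ *m V *m U^t*]mulmxA.
have -> : V *m U^t* = (U *m V^t*)^t*.
  by rewrite trmx_mul map_mxM /= trmxCK.
rewrite -[_ *m U *m _]mulmxA; move: (U *m V^t*) => W.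
rewrite /mxtrace; apply: eq_bigr => i _; rewrite mxE; apply: eq_bigr => j _.
rewrite mul_mx_diag mul_diag_mx !mxE.
by rewrite -!mulrA; congr (_ * _); rewrite mulrCA.
Qed.

Lemma unitary_diag_quadform U V a i : V \is unitarymx ->
  (U *m unitary_diag V a *m U^t*) i i =
  \sum_j a ord0 j * ((U *m V^t*) i j * ((U *m V^t*) i j)^*).
Proof.
move=> Vu; have -> : U *m unitary_diag V a *m U^t* = (U *m V^t*) *m diag_mx a *m (U *m V^t*)^t*.
  by rewrite /unitary_diag trmx_mul map_mxM /= trmxCK !mulmxA.
move: (U *m _) => W; rewrite mxE; apply: eq_bigr => j _.
by rewrite mul_mx_diag !mxE mulrCA mulrA.
Qed.

End ClosedField.

Section Spectral.
Context {R : realType} {n : nat}.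
Implicit Types (U V A B : 'M[R[i]]_n) (a b : 'I_n -> R).

Definition rowC a : 'rV[R[i]]_n := \row_j (a j)%:C.

(** Hermitian matrices are handled through an arbitrary unitary [U] and a real diagonal, so that
    arguments do not depend on the choice made by [spectralmx]. *)
Definition udiag U a : 'M[R[i]]_n := unitary_diag U (rowC a).

Lemma udiagE U a p q : udiag U a p q = \sum_j (a j)%:C * ((U j p)^* * U j q).
Proof. by rewrite unitary_diagE; apply: eq_bigr => j _; rewrite mxE. Qed.

Lemma hermP A : A \is hermsymmx <-> A^t* = A.
Proof.
by split=> [/is_hermitianmxP|hA]; [|apply/is_hermitianmxP]; rewrite expr0 scale1r.
Qed.

Lemma udiag_herm U a : udiag U a \is hermsymmx.
Proof.
apply/hermP; apply/matrixP => p q; rewrite [LHS]mxE [X in _ X = _]mxE.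
rewrite !udiagE rmorph_sum; apply: eq_bigr => j _.
rewrite !rmorphM/= conjCK [X in _ * X = _]mulrC; congr (_ * _).
exact/conjc_real.
Qed.

Lemma spectral_diag_rowC A : A \is hermsymmx ->
  spectral_diag A = rowC (fun j => complex.Re (spectral_diag A ord0 j)).
Proof.
move=> hA; apply/rowP => j; rewrite mxE; apply/esym/RRe_real.
by have /mxOverP := hermitian_spectral_diag_real hA; apply.
Qed.

Lemma herm_udiag A : A \is hermsymmx ->
  A = udiag (spectralmx A) (fun j => complex.Re (spectral_diag A ord0 j)).
Proof.
move=> hA; rewrite {1}(spectral_unitary_diag A hA) /udiag.
by congr unitary_diag; exact: spectral_diag_rowC.
Qed.

Lemma udiag_perm_eq U V a b : U \is unitarymx -> V \is unitarymx ->
  udiag U a = udiag V b -> perm_eq (codom a) (codom b).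
Proof.
move=> Uu Vu /(unitary_diag_perm_eq _ _ _ _ Uu Vu) /(perm_map (@complex.Re R)).
have E c : [seq complex.Re z | z <- codom (rowC c ord0)] = codom c.
  by rewrite /codom /image_mem -map_comp; apply: eq_map => j; rewrite /= mxE.
by rewrite !E.
Qed.

Lemma specfun_udiag (f : R -> R) U a : U \is unitarymx ->
  specfun f (udiag U a) = udiag U (f \o a).
Proof.
move=> Uu; have hA := udiag_herm U a; have Vu := spectral_unitarymx (udiag U a).
rewrite /specfun invmx_unitary//.
apply: (eq_unitary_diag _ _ _ _ _ _ Vu Uu _ (esym (spectral_unitary_diag _ hA))).
by move=> i j; rewrite !mxE => ->.
Qed.

Lemma eigvals_udiag U a : U \is unitarymx -> perm_eq (eigvals (udiag U a)) (codom a).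
Proof.
move=> Uu; rewrite perm_sort; have hA := udiag_herm U a.
apply: (udiag_perm_eq (spectralmx (udiag U a)) U); rewrite ?spectral_unitarymx//.
exact/esym/herm_udiag.
Qed.

Lemma size_eigvals A : size (eigvals A) = n.
Proof. by rewrite size_sort size_map size_enum_ord. Qed.

Lemma lambda_mono A i j : (i <= j < n)%N -> lambda j.+1 A <= lambda i.+1 A.
Proof.
move=> /andP[ij jn]; rewrite /lambda /=.
have : sorted >=%R (eigvals A) by apply: sort_sorted => x y; exact: ge_total.
move=> /(sorted_leq_nth ge_trans ge_refl) H; apply: (H 0 i j) => //.
  by rewrite inE size_eigvals (leq_ltn_trans ij).
by rewrite inE size_eigvals.
Qed.

Lemma lambda_udiag_nth U a : U \is unitarymx ->
  {homo a : i j / (i <= j)%N >-> j <= i} -> forall j : 'I_n, lambda j.+1 (udiag U a) = a j.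
Proof.
move=> Uu amon j; rewrite /lambda /=.
have -> : eigvals (udiag U a) = codom a.
  apply: (@sorted_eq _ >=%R) (eigvals_udiag _ _ Uu).
  - exact: ge_trans.
  - exact: ge_anti.
  - by apply: sort_sorted => x y; exact: ge_total.
  rewrite /codom /image_mem sorted_map; apply: (@sub_sorted _ (relpre val leq)).
    exact: amon.
  by rewrite -sorted_map val_enum_ord iota_sorted.
by rewrite /codom /image_mem (nth_map j) ?size_enum_ord// nth_ord_enum.
Qed.

(** The permutation that sorts the eigenvalues is applied to the rows of [spectralmx A]. *)
Lemma herm_lambda A : A \is hermsymmx ->
  exists2 U, U \is unitarymx & A = udiag U (fun j => lambda j.+1 A).
Proof.
move=> hA; have E := herm_udiag _ hA; set a := (fun j => _) in E.
have := eigvals_udiag _ a (spectral_unitarymx A); rewrite -E => pe.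
have sz : size (eigvals A) == n by rewrite size_eigvals.
have /tuple_permP[s sE] : perm_eq (Tuple sz) [tuple a j | j < n].
  by apply: perm_trans pe _; rewrite perm_refl.
exists (row_perm s (spectralmx A)); first exact/row_perm_unitary/spectral_unitarymx.
rewrite {1}E /udiag -(unitary_diag_row_perm s); congr unitary_diag.
apply/rowP => j; rewrite !mxE /lambda -[nth _ _ _]/((Tuple sz)`_j).
by rewrite sE -tnth_nth !tnth_mktuple.
Qed.

End Spectral.

(** * Ky Fan's principle and the k-trace *)

Lemma elsym_perm (R : comNzRingType) n (s : 'S_n) k (x : 'I_n -> R) :
  elsym [set: 'I_n] k (fun i => x (s i)) = elsym [set: 'I_n] k x.
Proof.
rewrite /elsym [RHS](reindex_inj (imset_inj (@perm_inj _ s))); apply: eq_big => J.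
  by rewrite !finset.subsetT card_imset//; exact: perm_inj.
by move=> _; rewrite big_imset//= => i j _ _; exact: perm_inj.
Qed.

Section Overlap.
Context {R : realType} {n : nat}.
Implicit Types (U V A B : 'M[R[i]]_n) (a b : 'I_n -> R).

(** The squared moduli of the inner products of two orthonormal bases. This matrix is doubly
    stochastic and turns traces of products into scalar double sums. *)
Definition overlap U V (i j : 'I_n) : R := sqnorm ((U *m V^t*) i j).

Lemma overlap_ge0 U V i j : 0 <= overlap U V i j.
Proof. exact: sqnorm_ge0. Qed.

Lemma overlapC U V i j : overlap U V i j = overlap V U j i.
Proof.
rewrite /overlap -sqnormJ; congr sqnorm.
rewrite -(mulmxtC_adj U V).
by rewrite [RHS]mxE [X in _ = _ X]mxE.
Qed.

Lemma sum_overlap U V i : U \is unitarymx -> V \is unitarymx ->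
  \sum_j overlap U V i j = 1.
Proof.
move=> Uu Vu.
have := unitary_row_norm _ i (unitary_mulmxtC _ _ Uu Vu).
move=> /(congr1 (@complex.Re R)); rewrite Re_sum => /= E; rewrite -[RHS]E.
by apply: eq_bigr => j _; rewrite mulcJ.
Qed.

Lemma sum_overlapl U V j : U \is unitarymx -> V \is unitarymx ->
  \sum_i overlap U V i j = 1.
Proof.
by move=> Uu Vu; rewrite -(sum_overlap V U j)//; apply: eq_bigr => i _; rewrite overlapC.
Qed.

(** Real parts give values that can be compared in [R]; the trace of a product of two Hermitian
    matrices is real anyway. *)
Definition retr A : R := complex.Re (\tr A).

Lemma retrD A B : retr (A + B) = retr A + retr B.
Proof. by rewrite /retr mxtraceD ReD. Qed.

Lemma retrN A : retr (- A) = - retr A.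
Proof. by rewrite /retr linearN/= ReN. Qed.

Lemma retrB A B : retr (A - B) = retr A - retr B.
Proof. by rewrite retrD retrN. Qed.

Lemma retrZ (c : R) A : retr (c%:C *: A) = c * retr A.
Proof. by rewrite /retr mxtraceZ ReZ. Qed.

Lemma retr_mulC A B : retr (A *m B) = retr (B *m A).
Proof. by rewrite /retr mxtrace_mulC. Qed.

Lemma retr_udiag U a : U \is unitarymx -> retr (udiag U a) = \sum_j a j.
Proof.
move=> Uu; rewrite /retr mxtrace_unitary_diag// Re_sum.
by apply: eq_bigr => j _; rewrite mxE.
Qed.

Lemma retr_udiagM U V a b :
  retr (udiag U a *m udiag V b) = \sum_i \sum_j a i * b j * overlap U V i j.
Proof.
rewrite /retr mxtrace_unitary_diagM Re_sum; apply: eq_bigr => i _.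
rewrite Re_sum; apply: eq_bigr => j _.
by rewrite 2![rowC _ _ _]mxE mulcJ -mulrA !ReZ mulrA.
Qed.

Lemma Re_udiag_quadform U V a i : V \is unitarymx ->
  complex.Re ((U *m udiag V a *m U^t*) i i) = \sum_j a j * overlap U V i j.
Proof.
move=> Vu; rewrite unitary_diag_quadform// Re_sum; apply: eq_bigr => j _.
by rewrite [rowC _ _ _]mxE mulcJ ReZ.
Qed.

End Overlap.

Section KyFan.
Context {R : realType} {n : nat}.
Implicit Types (U V A B : 'M[R[i]]_n) (a b : 'I_n -> R).

Definition topsum (r : nat) A : R := \sum_(j < r) lambda j.+1 A.

(** Each diagonal entry averages the eigenvalues with overlaps as weights. Over r rows the weights
    lie in [0, 1], by the column sums, and have total r, by the row sums, so [sum_weight_le]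
    applies. *)
Lemma kyfan_le r U A : (r <= n)%N -> U \is unitarymx -> A \is hermsymmx ->
  \sum_(i < n | (i < r)%N) complex.Re ((U *m A *m U^t*) i i) <= topsum r A.
Proof.
move=> rn Uu /herm_lambda[V Vu AE].
rewrite (eq_bigr (fun i => \sum_j lambda (val j).+1 A * overlap U V i j)); last first.
  by move=> i _; rewrite {1}AE; exact: Re_udiag_quadform.
rewrite exchange_big/=.
pose p j := \sum_(i < n | (i < r)%N) overlap U V i j.
rewrite (eq_bigr (fun j => p j * lambda (val j).+1 A)); last first.
  by move=> j _; rewrite -big_distrr/= mulrC.
apply: (sum_weight_le _ _ _ (fun j => lambda j.+1 A)) => //.
- by move=> i j; exact: lambda_mono.
- move=> j; rewrite sumr_ge0/= => [|i _]; last exact: overlap_ge0.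
  rewrite -(sum_overlapl U V j)// [leRHS](bigID (fun i : 'I_n => (i < r)%N))/= lerDl.
  by apply: sumr_ge0 => i _; exact: overlap_ge0.
- rewrite exchange_big/= (eq_bigr (fun=> 1)) => [|i _]; last exact: sum_overlap.
  by rewrite -(big_ord_widen n (fun=> 1) rn) sumr_const card_ord.
Qed.

Lemma kyfan_eq A : A \is hermsymmx ->
  exists2 U, U \is unitarymx & forall r, (r <= n)%N ->
    \sum_(i < n | (i < r)%N) complex.Re ((U *m A *m U^t*) i i) = topsum r A.
Proof.
move=> /herm_lambda[U Uu AE]; exists U => // r rn.
rewrite /topsum (big_ord_widen n (fun j => lambda j.+1 A))//.
apply: eq_bigr => i _; rewrite {1}AE unitary_diag_conj//.
by rewrite mxE eqxx mxE.
Qed.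

Lemma hermD A B : A \is hermsymmx -> B \is hermsymmx -> A + B \is hermsymmx.
Proof. by move=> /hermP hA /hermP hB; apply/hermP; rewrite linearD/= map_mxD hA hB. Qed.

Lemma hermN A : A \is hermsymmx -> - A \is hermsymmx.
Proof. by move=> /hermP hA; apply/hermP; rewrite linearN/= map_mxN hA. Qed.

Lemma hermZ (c : R) A : A \is hermsymmx -> c%:C *: A \is hermsymmx.
Proof.
move=> /hermP hA; apply/hermP; rewrite linearZ/= map_mxZ/= hA; congr (_ *: _).
exact: conjc_real.
Qed.

(** By Ky Fan's principle [topsum r] is a maximum of linear functionals. *)
Lemma topsumD r A B : (r <= n)%N -> A \is hermsymmx -> B \is hermsymmx ->
  topsum r (A + B) <= topsum r A + topsum r B.
Proof.
move=> rn hA hB; have [U Uu /(_ _ rn) <-] := kyfan_eq _ (hermD _ _ hA hB).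
apply: le_trans (lerD (kyfan_le _ _ _ rn Uu hA) (kyfan_le _ _ _ rn Uu hB)).
by rewrite -big_split/= ler_sum// => i _; rewrite mulmxDr mulmxDl mxE ReD.
Qed.

Lemma topsum_retr A : A \is hermsymmx -> topsum n A = retr A.
Proof. by move=> /herm_lambda[U Uu {2}->]; rewrite retr_udiag. Qed.

Lemma udiag_perm (s : 'S_n) U a : udiag (row_perm s U) (fun j => a (s j)) = udiag U a.
Proof.
rewrite /udiag -[RHS](unitary_diag_row_perm s); congr unitary_diag.
by apply/rowP => j; rewrite !mxE.
Qed.

Lemma udiagN U a : - udiag U a = udiag U (fun j => - a j).
Proof.
rewrite /udiag unitary_diagN; congr unitary_diag.
by apply/rowP => j; rewrite !mxE -rmorphN.
Qed.

Lemma udiagZ (c : R) U a : c%:C *: udiag U a = udiag U (fun j => c * a j).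
Proof.
rewrite /udiag unitary_diagZ; congr unitary_diag.
by apply/rowP => j; rewrite !mxE -rmorphM.
Qed.

Lemma udiagD U a b : udiag U a + udiag U b = udiag U (fun j => a j + b j).
Proof.
rewrite /udiag unitary_diagD; congr unitary_diag.
by apply/rowP => j; rewrite !mxE -rmorphD.
Qed.

Lemma lambda_udiagE U a (g : nat -> R) : U \is unitarymx ->
  (forall j : 'I_n, a j = g j) -> (forall i j, (i <= j < n)%N -> g j <= g i) ->
  forall j, (j < n)%N -> lambda j.+1 (udiag U a) = g j.
Proof.
move=> Uu ag gmon j jn; rewrite -[RHS](ag (Ordinal jn)) -(lambda_udiag_nth U a Uu _ (Ordinal jn))//.
by move=> i l il; rewrite !ag gmon// il ltn_ord.
Qed.

Lemma specfun_lambda (f : R -> R) A : A \is hermsymmx ->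
  {homo f : x y / x <= y} -> forall j, (j < n)%N ->
  lambda j.+1 (specfun f A) = f (lambda j.+1 A).
Proof.
move=> /herm_lambda[U Uu AE] fmon j jn; rewrite {1}AE specfun_udiag//.
apply: (lambda_udiagE U _ (fun j => f (lambda j.+1 A))) => // i l il.
by rewrite fmon// lambda_mono.
Qed.

Lemma lambdaN A j : A \is hermsymmx -> (j < n)%N -> lambda j.+1 (- A) = - lambda (n - j) A.
Proof.
move=> /herm_lambda[U Uu AE] jn; rewrite {1}AE udiagN -(udiag_perm (perm (@rev_ord_inj n))).
apply: (lambda_udiagE _ _ (fun j => - lambda (n - j) A) (row_perm_unitary _ _ Uu) _ _ j jn).
  by move=> i; rewrite permE /= subnSK.
move=> i l /andP[il ln]; rewrite lerN2.
by rewrite -(subnSK ln) -(subnSK (leq_ltn_trans il ln)) lambda_mono//; lia.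
Qed.

Lemma topsumN r A : A \is hermsymmx -> (r <= n)%N ->
  \sum_(j < r) lambda (n - j) A = - topsum r (- A).
Proof.
move=> hA rn; rewrite /topsum -sumrN; apply: eq_bigr => j _.
by rewrite lambdaN ?opprK// (leq_trans (ltn_ord j)).
Qed.

Lemma lambdaZ (c : R) A j : A \is hermsymmx -> (j < n)%N -> 0 <= c ->
  lambda j.+1 (c%:C *: A) = c * lambda j.+1 A.
Proof.
move=> /herm_lambda[U Uu AE] jn c0.
rewrite {1}AE udiagZ; apply: (lambda_udiagE U _ (fun j => c * lambda j.+1 A)) => //.
by move=> i l il; rewrite ler_wpM2l// lambda_mono.
Qed.

Lemma topsumZ r (c : R) A : A \is hermsymmx -> (r <= n)%N -> 0 <= c ->
  topsum r (c%:C *: A) = c * topsum r A.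
Proof.
move=> hA rn c0; rewrite /topsum mulr_sumr; apply: eq_bigr => j _.
by rewrite lambdaZ// (leq_trans _ rn).
Qed.

Lemma Tr_elsym k A : Tr k A = elsym [set: 'I_n] k (fun j => lambda j.+1 A).
Proof. by apply: eq_bigl => J; rewrite finset.subsetT. Qed.

Lemma Tr_expmx k A : A \is hermsymmx ->
  Tr k (expmx A) = elsym [set: 'I_n] k (fun j => expR (lambda j.+1 A)).
Proof.
move=> hA; rewrite Tr_elsym; apply: eq_bigr => J _; apply: eq_bigr => j _.
by rewrite specfun_lambda// => x y; rewrite ler_expR.
Qed.

Lemma retr_expmx A : A \is hermsymmx -> retr (expmx A) = \sum_(j < n) expR (lambda j.+1 A).
Proof.
by move=> /herm_lambda[U Uu {1}->]; rewrite /expmx specfun_udiag// retr_udiag.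
Qed.

(* lambda(K) is majorized by lambda(K + L) + lambda(- L) by Ky Fan, and
   elsym k o exp is Schur-convex. *)
Lemma elsym_exp_le k (K : 'M[R[i]]_n) V (l : 'I_n -> R) :
  K \is hermsymmx -> V \is unitarymx ->
  (forall x : 'I_n -> R, (forall i, 0 < x i) ->
    elsym [set: 'I_n] k x <= (\sum_i expR (l i) * x i) ^+ k) ->
  elsym [set: 'I_n] k (fun j => expR (lambda j.+1 K)) <=
    retr (expmx (K + udiag V l)) ^+ k.
Proof.
move=> hK Vu supp; set L := udiag V l; have hL : L \is hermsymmx := udiag_herm V l.
have hP := hermD _ _ hK hL; have hNL := hermN _ hL.
have KE : K = (K + L) - L by rewrite addrK.
pose p j := lambda j.+1 (K + L); pose m j := lambda j.+1 (- L).
have sumE r : \sum_(j < r) (p j + m j) = topsum r (K + L) + topsum r (- L).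
  by rewrite big_split.
apply: (@le_trans _ _ (elsym [set: 'I_n] k (fun j => expR (p j + m j)))).
  apply: (elsym_exp_majorize R n k (fun j => lambda j.+1 K) (fun j => p j + m j)).
  - by move=> i j; exact: lambda_mono.
  - by move=> r rn; rewrite sumE -/(topsum r K) {1}KE topsumD.
  - by rewrite sumE -/(topsum n K) !topsum_retr// -retrD -KE.
have sz : size (eigvals (- L)) == n by rewrite size_eigvals.
have /tuple_permP[s sE] : perm_eq (Tuple sz) [tuple - l j | j < n].
  by have := eigvals_udiag V (fun j => - l j) Vu; rewrite -udiagN.
have mE (j : 'I_n) : m j = - l (s j).
  by rewrite /m /lambda -[nth _ _ _]/((Tuple sz)`_j) sE -tnth_nth !tnth_mktuple.
(* The weights [expR (l i)] are indexed by the basis [V], while [p] and [m] are sorted. Reindexing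
   by [s] changes no symmetric function, and makes the weights cancel, leaving the trace of exp (K +
   L). *)
pose x j := expR (p ((s^-1)%g j) - l j).
rewrite (_ : elsym _ _ _ = elsym [set: 'I_n] k (fun j => x (s j))); last first.
  by apply: eq_bigr => J _; apply: eq_bigr => j _; rewrite mE /x permK.
rewrite elsym_perm; apply: le_trans (supp x _) _ => [i|]; first exact: expR_gt0.
rewrite retr_expmx// [X in X ^+ k](reindex_inj (@perm_inj _ s)).
rewrite (eq_bigr (fun i : 'I_n => expR (p i)))// => j _.
by rewrite /x permK -expRD addrC subrK.
Qed.

End KyFan.

(** * Relative entropy *)

Section LogSums.
Variable R : realType.
Implicit Types t a : R.

Let den_gt0 t a (N r : nat) : 0 < t -> 0 < a -> (0 < N)%N -> (r <= N)%N ->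
  0 < N%:R * t - r%:R * (t - a).
Proof.
move=> t0 a0 N0 rN; have -> : N%:R * t - r%:R * (t - a) = (N%:R - r%:R) * t + r%:R * a by ring.
have : (r%:R <= N%:R :> R) by rewrite ler_nat.
rewrite le_eqVlt => /orP[/eqP ->|lt].
  by rewrite subrr mul0r add0r mulr_gt0// ltr0n.
by rewrite ltr_pwDl ?mulr_gt0 ?subr_gt0// mulr_ge0// ltW.
Qed.

Let ln_le t : 0 < t -> ln t <= t - 1.
Proof. by move=> t0; rewrite -[in ln t](subrK 1 t) [_ + 1]addrC le_ln1Dx// ltrBrDl subrr. Qed.

(** The arguments of [ln] are [N] times the points dividing the segment from [t] to [a] into [N]
    equal parts. *)
Let ln_telescope t a (N : nat) : 0 < t -> 0 < a -> (0 < N)%N ->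
  ln t - ln a = \sum_(r < N) (ln (N%:R * t - r%:R * (t - a)) -
                              ln (N%:R * t - r.+1%:R * (t - a))).
Proof.
move=> t0 a0 N0.
rewrite -(big_mkord predT (fun r => ln (N%:R * t - r%:R * (t - a)) -
                              ln (N%:R * t - r.+1%:R * (t - a)))).
rewrite -[RHS]opprK -sumrN.
under eq_bigr do rewrite opprB.
rewrite telescope_sumr// opprB mul0r subr0.
have -> : N%:R * t - N%:R * (t - a) = N%:R * a by ring.
by rewrite !lnM ?posrE ?ltr0n//; ring.
Qed.

(** A left Riemann sum of (t - a) / ((1 - u) t + u a), which increases with u. Term by term this is
    ln x <= x - 1. *)
Lemma sum_le_ln t a (N : nat) : 0 < t -> 0 < a -> (0 < N)%N ->
  \sum_(r < N) (t - a) / (N%:R * t - r%:R * (t - a)) <= ln t - ln a.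
Proof.
move=> t0 a0 N0; rewrite (ln_telescope _ _ N)//; apply: ler_sum => r _.
have D0 := den_gt0 t a N r t0 a0 N0 (ltnW (ltn_ord r)).
have D1 := den_gt0 t a N r.+1 t0 a0 N0 (ltn_ord r).
rewrite -lerN2 opprB -ln_div ?posrE//.
apply: le_trans (ln_le _ (divr_gt0 D1 D0)) _; rewrite -(natr1 r) in D1 *.
rewrite le_eqVlt; apply/orP; left; apply/eqP; field; exact: lt0r_neq0.
Qed.

(** The right Riemann sum is an upper bound, and exceeds the left one by the difference of the end
    terms, which is the correction. *)
Lemma ln_le_sum t a (N : nat) : 0 < t -> 0 < a -> (0 < N)%N ->
  ln t - ln a <= \sum_(r < N) (t - a) / (N%:R * t - r%:R * (t - a)) +
    (t - a) ^+ 2 / (N%:R * a * t).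
Proof.
move=> t0 a0 N0.
have Nr0 : 0 < N%:R :> R by rewrite ltr0n.
have -> : (t - a) ^+ 2 / (N%:R * a * t) =
  (t - a) / (N%:R * t - N%:R * (t - a)) - (t - a) / (N%:R * t - 0%:R * (t - a)).
  rewrite mul0r subr0; have -> : N%:R * t - N%:R * (t - a) = N%:R * a by ring.
  by field; rewrite !gt_eqF.
pose F r := (t - a) / (N%:R * t - r%:R * (t - a)).
rewrite -/(F N) -/(F 0%N) -(telescope_sumr F (leq0n N)) big_mkord -big_split/=.
rewrite (ln_telescope _ _ N)//; apply: ler_sum => r _; rewrite -/(F r) addrC subrK /F.
have D0 := den_gt0 t a N r t0 a0 N0 (ltnW (ltn_ord r)).
have D1 := den_gt0 t a N r.+1 t0 a0 N0 (ltn_ord r).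
rewrite -ln_div ?posrE//; apply: le_trans (ln_le _ (divr_gt0 D0 D1)) _.
rewrite -(natr1 r) in D1 *.
rewrite le_eqVlt; apply/orP; left; apply/eqP; field; exact: lt0r_neq0.
Qed.

(** Writing N t as the denominator plus r (t - a) splits off a part linear in (t, a) and leaves a
    square over a linear form, which is jointly convex. *)
Lemma log_sum_termE t a (N r : nat) : 0 < t -> 0 < a -> (0 < N)%N -> (r <= N)%N ->
  t * ((t - a) / (N%:R * t - r%:R * (t - a))) =
  (t - a) / N%:R + r%:R / N%:R ^+ 2 *
    ((t - a) ^+ 2 / ((1 - r%:R / N%:R) * t + r%:R / N%:R * a)).
Proof.
move=> t0 a0 N0 rN; have D0 := den_gt0 t a N r t0 a0 N0 rN.
have Nr0 : 0 < N%:R :> R by rewrite ltr0n.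
have -> : (1 - r%:R / N%:R) * t + r%:R / N%:R * a = (N%:R * t - r%:R * (t - a)) / N%:R.
  by field; exact: lt0r_neq0.
by field; rewrite !lt0r_neq0.
Qed.

End LogSums.

(** * Traces in the coordinates of two eigenbases *)

Section TraceCoordinates.
Context {C : numClosedFieldType} {n : nat}.
Implicit Types (U V Y : 'M[C]_n) (a b : 'rV[C]_n).

Lemma mxtrace_adjM Y (M : 'M[C]_n) : \tr (Y^t* *m M) = \sum_i \sum_j (Y i j)^* * M i j.
Proof.
rewrite exchange_big; apply: eq_bigr => j _; rewrite mxE; apply: eq_bigr => i _.
by rewrite !mxE.
Qed.

(** In these coordinates left multiplication by [unitary_diag U a] scales rows and right
    multiplication by [unitary_diag V b] scales columns, so the operator Z |-> (1 - u) T Z + u Z A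
    becomes diagonal. *)
Lemma unitary_coordK U V Y : U \is unitarymx -> V \is unitarymx ->
  Y = U^t* *m (U *m Y *m V^t*) *m V.
Proof. by move=> Uu Vu; rewrite !mulmxA unitaryKr// mul1mx -mulmxA unitaryKr// mulmx1. Qed.

Lemma mxtrace_coord_left U V Y a : U \is unitarymx -> V \is unitarymx ->
  \tr ((U^t* *m Y *m V)^t* *m unitary_diag U a) =
  \sum_i \sum_j (Y i j)^* * (a ord0 i * (U *m V^t*) i j).
Proof.
move=> Uu Vu; rewrite !trmx_mul !map_mxM/= trmxCK /unitary_diag !mulmxA.
rewrite -[_ *m U *m U^t*]mulmxA unitaryKl// mulmx1 -!mulmxA mxtrace_mulC -!mulmxA.
rewrite mxtrace_adjM; apply: eq_bigr => i _; apply: eq_bigr => j _.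
by rewrite mul_diag_mx mxE.
Qed.

Lemma mxtrace_coord_right U V Y b : U \is unitarymx -> V \is unitarymx ->
  \tr ((U^t* *m Y *m V)^t* *m unitary_diag V b) =
  \sum_i \sum_j (Y i j)^* * (b ord0 j * (U *m V^t*) i j).
Proof.
move=> Uu Vu; rewrite !trmx_mul !map_mxM/= trmxCK /unitary_diag -!mulmxA mxtrace_mulC -!mulmxA.
rewrite unitaryKl// mulmx1.
rewrite mxtrace_adjM; apply: eq_bigr => i _; apply: eq_bigr => j _.
by rewrite mulmxA mul_mx_diag mxE [_ * b _ _]mulrC.
Qed.

Lemma mxtrace_coord_sql U V Y a : U \is unitarymx -> V \is unitarymx ->
  let Z := U^t* *m Y *m V in
  \tr (Z *m Z^t* *m unitary_diag U a) = \sum_i \sum_j (Y i j)^* * (a ord0 i * Y i j).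
Proof.
move=> Uu Vu Z; rewrite /Z !trmx_mul !map_mxM/= trmxCK /unitary_diag !mulmxA.
rewrite -[_ *m V *m V^t*]mulmxA unitaryKl// mulmx1.
rewrite -[_ *m U *m U^t*]mulmxA unitaryKl// mulmx1 -!mulmxA mxtrace_mulC -!mulmxA.
rewrite unitaryKl// mulmx1 mxtrace_mulC -mulmxA.
rewrite mxtrace_adjM; apply: eq_bigr => i _; apply: eq_bigr => j _.
by rewrite mul_diag_mx mxE.
Qed.

Lemma mxtrace_coord_sqr U V Y b : U \is unitarymx -> V \is unitarymx ->
  let Z := U^t* *m Y *m V in
  \tr (Z^t* *m Z *m unitary_diag V b) = \sum_i \sum_j (Y i j)^* * (b ord0 j * Y i j).
Proof.
move=> Uu Vu Z; rewrite /Z !trmx_mul !map_mxM/= trmxCK /unitary_diag !mulmxA.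
rewrite -[_ *m U *m U^t*]mulmxA unitaryKl// mulmx1.
rewrite -[_ *m V *m V^t*]mulmxA unitaryKl// mulmx1 -!mulmxA mxtrace_mulC -!mulmxA.
rewrite unitaryKl// mulmx1.
rewrite mxtrace_adjM; apply: eq_bigr => i _; apply: eq_bigr => j _.
by rewrite mul_mx_diag mxE [_ * b _ _]mulrC.
Qed.

End TraceCoordinates.

(** * Joint convexity of the relative entropy *)

Section RelativeEntropy.
Context {R : realType} {n : nat}.
Implicit Types (U V A T S Z M : 'M[R[i]]_n) (a t : 'I_n -> R).

Definition pd A := exists U a, [/\ U \is unitarymx, forall j, 0 < a j & A = udiag U a].

Definition relent T A : R := retr (T *m (lnmx T - lnmx A)).

Lemma sum_overlapM U V a : U \is unitarymx -> V \is unitarymx ->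
  \sum_i \sum_j overlap U V i j * a i = \sum_i a i.
Proof.
by move=> Uu Vu; apply: eq_bigr => i _; rewrite -mulr_suml sum_overlap// mul1r.
Qed.

Lemma sum_overlapMr U V a : U \is unitarymx -> V \is unitarymx ->
  \sum_i \sum_j overlap U V i j * a j = \sum_i a i.
Proof.
move=> Uu Vu; rewrite exchange_big; apply: eq_bigr => j _.
by rewrite -mulr_suml sum_overlapl// mul1r.
Qed.

Lemma relent_udiag U V t a : U \is unitarymx -> V \is unitarymx ->
  relent (udiag U t) (udiag V a) =
  \sum_i \sum_j overlap U V i j * (t i * (ln (t i) - ln (a j))).
Proof.
move=> Uu Vu; rewrite /relent mulmxBr retrB /lnmx !specfun_udiag// !retr_udiagM.
(* The overlap matrix of [U] with itself is the identity. *)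
rewrite [X in X - _](_ : _ = \sum_i t i * ln (t i)); last first.
  apply: eq_bigr => i _; rewrite (bigD1 i)//= /overlap (unitaryKl Uu) mxE eqxx.
  rewrite big1 ?addr0.
    by rewrite /sqnorm /= expr1n expr0n addr0 mulr1.
  by move=> j ji; rewrite mxE eq_sym (negbTE ji) /sqnorm /= expr0n addr0 mulr0.
rewrite -(sum_overlapM U V (fun i => t i * ln (t i)))// -sumrB.
apply: eq_bigr => i _; rewrite -sumrB; apply: eq_bigr => j _.
by rewrite mulrBr mulrBr; congr (_ - _); rewrite mulrC.
Qed.

(** Klein's inequality: the scalar bound is [sum_le_ln] with N = 1, averaged over the overlaps. *)
Lemma klein T S : pd T -> pd S -> retr T - retr S <= relent T S.
Proof.
move=> [U [t [Uu t0 ->]]] [V [s [Vu s0 ->]]]; rewrite relent_udiag// !retr_udiag//.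
rewrite -(sum_overlapM U V t)// -(sum_overlapMr U V s)// -sumrB.
apply: ler_sum => i _; rewrite -sumrB; apply: ler_sum => j _.
rewrite -mulrBr ler_wpM2l ?overlap_ge0//.
have := sum_le_ln R (t i) (s j) 1 (t0 i) (s0 j) isT.
rewrite big_ord_recl big_ord0 addr0 mul0r subr0 mul1r ler_pdivrMr// mulrC//.
Qed.

(* [quadratic Z u] is a lower bound, linear in [T] and [A], of the quadratic
   form of [T - A] with respect to the inverse of
   [Z |-> (1 - u) T Z + u Z A]; it is attained for an optimal [Z]. *)
Definition quadratic Z (u : R) T A : R :=
  2 * retr (Z^t* *m (T - A)) - (1 - u) * retr (Z *m Z^t* *m T)
  - u * retr (Z^t* *m Z *m A).

Lemma quadratic_coord U V Y u t a : U \is unitarymx -> V \is unitarymx ->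
  quadratic (U^t* *m Y *m V) u (udiag U t) (udiag V a) =
  \sum_i \sum_j (2 * (t i - a j) * complex.Re ((Y i j)^* * (U *m V^t*) i j)
     - ((1 - u) * t i + u * a j) * sqnorm (Y i j)).
Proof.
move=> Uu Vu; rewrite /quadratic mulmxBr retrB /retr.
rewrite (mxtrace_coord_left U V Y (rowC t) Uu Vu) (mxtrace_coord_right U V Y (rowC a) Uu Vu).
rewrite (mxtrace_coord_sql U V Y (rowC t) Uu Vu) (mxtrace_coord_sqr U V Y (rowC a) Uu Vu).
have E1 c (w : 'I_n -> 'I_n -> R[i]) (f : 'I_n -> 'I_n -> 'I_n) :
    complex.Re (\sum_i \sum_j (Y i j)^* * (rowC c ord0 (f i j) * w i j)) =
    \sum_i \sum_j c (f i j) * complex.Re ((Y i j)^* * w i j).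
  rewrite Re_sum; apply: eq_bigr => i _; rewrite Re_sum; apply: eq_bigr => j _.
  by rewrite mxE mulrCA ReZ.
rewrite (E1 t _ (fun i j => i)) (E1 a _ (fun i j => j)).
rewrite (E1 t _ (fun i j => i)) (E1 a _ (fun i j => j)).
rewrite -sumrB !mulr_sumr -!sumrB; apply: eq_bigr => i _.
rewrite -sumrB !mulr_sumr -!sumrB; apply: eq_bigr => j _.
by rewrite mulJc /=; ring.
Qed.

(** Completing the square in every coordinate. *)
Lemma quadratic_le U V Z u t a : U \is unitarymx -> V \is unitarymx ->
  (forall i j, 0 < (1 - u) * t i + u * a j) ->
  quadratic Z u (udiag U t) (udiag V a) <=
  \sum_i \sum_j overlap U V i j * ((t i - a j) ^+ 2 / ((1 - u) * t i + u * a j)).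
Proof.
move=> Uu Vu D0; rewrite {1}(unitary_coordK U V Z Uu Vu) (quadratic_coord U V _ u t a Uu Vu); apply: ler_sum => i _; apply: ler_sum => j _.
rewrite /overlap mulrA ler_pdivlMr//; set D := (1 - u) * t i + u * a j; set d := t i - a j.
case: ((U *m Z *m _) i j) => y1 y2; case: ((U *m _) i j) => w1 w2; rewrite /sqnorm/=.
rewrite -subr_ge0; set e := (X in 0 <= X).
have -> : e = (D * y1 - d * w1) ^+ 2 + (D * y2 - d * w2) ^+ 2 by rewrite /e; ring.
by rewrite addr_ge0// sqr_ge0.
Qed.

Lemma quadratic_eq U V u t a : U \is unitarymx -> V \is unitarymx ->
  (forall i j, 0 < (1 - u) * t i + u * a j) ->
  exists Z, quadratic Z u (udiag U t) (udiag V a) =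
  \sum_i \sum_j overlap U V i j * ((t i - a j) ^+ 2 / ((1 - u) * t i + u * a j)).
Proof.
move=> Uu Vu D0.
(* The coordinates at which the squares completed in [quadratic_le] vanish. *)
pose Y : 'M[R[i]]_n := \matrix_(i, j)
  (((t i - a j) / ((1 - u) * t i + u * a j))%:C * (U *m V^t*) i j).
exists (U^t* *m Y *m V).
rewrite (quadratic_coord U V Y u t a Uu Vu); apply: eq_bigr => i _; apply: eq_bigr => j _.
rewrite /overlap [Y i j]mxE; have := D0 i j; set D := _ + _; set d := t i - a j => D1.
case: ((_ *m _) i j) => w1 w2; rewrite /sqnorm/=; field; exact: lt0r_neq0.
Qed.

Lemma sum_log_overlap U V t a (N : nat) : U \is unitarymx -> V \is unitarymx ->
  (forall i, 0 < t i) -> (forall j, 0 < a j) -> (0 < N)%N ->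
  \sum_i \sum_j overlap U V i j *
    (t i * \sum_(r < N) (t i - a j) / (N%:R * t i - r%:R * (t i - a j))) =
  \sum_i t i - \sum_j a j + \sum_(r < N) r%:R / N%:R ^+ 2 *
    \sum_i \sum_j overlap U V i j *
      ((t i - a j) ^+ 2 / ((1 - r%:R / N%:R) * t i + r%:R / N%:R * a j)).
Proof.
move=> Uu Vu t0 a0 N0; have Nr0 : N%:R != 0 :> R by rewrite pnatr_eq0 -lt0n.
rewrite -(sum_overlapM U V t)// -(sum_overlapMr U V a)// -sumrB.
under [X in _ = _ + X]eq_bigr do rewrite mulr_sumr.
rewrite [X in _ = _ + X]exchange_big -big_split; apply: eq_bigr => i _ /=.
rewrite -sumrB.
under [X in _ = _ + X]eq_bigr do rewrite mulr_sumr.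
rewrite [X in _ = _ + X]exchange_big -big_split; apply: eq_bigr => j _ /=.
rewrite mulr_sumr (eq_bigr _ (fun (r : 'I_N) _ =>
  log_sum_termE R (t i) (a j) N r (t0 i) (a0 j) N0 (ltnW (ltn_ord r)))).
rewrite big_split /= sumr_const card_ord -[_ *+ N]mulr_natr divfK// mulrDr mulrBr mulr_sumr.
by congr (_ + _); apply: eq_bigr => r _; rewrite mulrCA.
Qed.

(** The representing matrices are kept because forms given by traces commute with expectations. *)
Definition is_linform (f : 'M[R[i]]_n -> 'M[R[i]]_n -> R) :=
  exists M1 M2, forall T A, f T A = retr (M1 *m T) + retr (M2 *m A).

Lemma linformD f g : is_linform f -> is_linform g -> is_linform (fun T A => f T A + g T A).
Proof.
move=> [M1 [M2 fE]] [N1 [N2 gE]]; exists (M1 + N1), (M2 + N2) => T A.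
by rewrite fE gE !mulmxDl !retrD addrACA.
Qed.

Lemma linformZ c f : is_linform f -> is_linform (fun T A => c * f T A).
Proof.
move=> [M1 [M2 fE]]; exists (c%:C *: M1), (c%:C *: M2) => T A.
by rewrite fE -!scalemxAl !retrZ mulrDr.
Qed.

Lemma linform_sum (N : nat) (f : 'I_N -> 'M[R[i]]_n -> 'M[R[i]]_n -> R) :
  (forall r, is_linform (f r)) -> is_linform (fun T A => \sum_r f r T A).
Proof.
elim: N f => [|N IH] f fl.
  by exists 0, 0 => T A; rewrite big_ord0 !mul0mx /retr linear0 addr0.
have [M1 [M2 E]] := linformD _ _ (IH _ (fun r => fl (widen_ord (leqnSn N) r))) (fl ord_max).
by exists M1, M2 => T A; rewrite big_ord_recr/= E.
Qed.

Lemma linform_l M : is_linform (fun T A => retr (M *m T)).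
Proof. by exists M, 0 => T A; rewrite mul0mx {3}/retr linear0 addr0. Qed.

Lemma linform_r M : is_linform (fun T A => retr (M *m A)).
Proof. by exists 0, M => T A; rewrite mul0mx {2}/retr linear0 add0r. Qed.

Lemma linform_quadratic Z u : is_linform (quadratic Z u).
Proof.
have [M1 [M2 E]] := linformD _ _
  (linformD _ _ (linformZ 2 _ (linform_l (Z^t*))) (linformZ (- 2) _ (linform_r (Z^t*))))
  (linformD _ _ (linformZ (- (1 - u)) _ (linform_l (Z *m Z^t*)))
                (linformZ (- u) _ (linform_r (Z^t* *m Z)))).
by exists M1, M2 => T A; rewrite -E /quadratic mulmxBr retrB; ring.
Qed.

(* Joint convexity of the relative entropy in supporting-hyperplane form: the
   Riemann sum of ln t - ln a splits into quadratic forms of T - A. *)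
Lemma relent_support T A (e : R) : pd T -> pd A -> 0 < e ->
  exists2 f, is_linform f & f T A + e >= relent T A /\
    forall T' A', pd T' -> pd A' -> f T' A' <= relent T' A'.
Proof.
move=> [U [t [Uu t0 ->]]] [V [a [Vu a0 ->]]] e0.
(* The error of the Riemann sum in the relative entropy is c / N, by the correction in [ln_le_sum]
   multiplied by [t i]. *)
pose c := \sum_i \sum_j overlap U V i j * ((t i - a j) ^+ 2 / a j).
have c0 : 0 <= c.
  apply: sumr_ge0 => i _; apply: sumr_ge0 => j _; rewrite mulr_ge0 ?overlap_ge0//.
  by rewrite divr_ge0 ?sqr_ge0// ltW.
pose N := (Num.bound (c / e)).+1.
have cN : c / N%:R <= e.
  rewrite ler_pdivrMr ?ltr0n// mulrC -ler_pdivrMr// ltW//.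
  apply: lt_le_trans (archi_boundP _) _; first by rewrite divr_ge0// ltW.
  by rewrite ler_nat.
have N0 : (0 < N)%N by [].
have Nr0 : 0 < N%:R :> R by rewrite ltr0n.
have den (r : 'I_N) (x y : R) : 0 < x -> 0 < y ->
    0 < (1 - r%:R / N%:R) * x + r%:R / N%:R * y.
  move=> x0 y0; rewrite ltr_pwDl//.
    by rewrite mulr_gt0// subr_gt0 ltr_pdivrMr// mul1r ltr_nat.
  by rewrite mulr_ge0 ?divr_ge0// ltW.
have /fin_all_exists[Z ZE] := fun r : 'I_N => quadratic_eq U V (r%:R / N%:R) t a Uu Vu
  (fun i j => den r _ _ (t0 i) (a0 j)).
exists (fun T A => (retr T - retr A) +
  \sum_(r < N) r%:R / N%:R ^+ 2 * quadratic (Z r) (r%:R / N%:R) T A).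
  apply: linformD.
    by exists 1%:M, (- 1%:M) => T' A'; rewrite mulNmx !mul1mx retrN.
  by apply: linform_sum => r; apply: linformZ; exact: linform_quadratic.
split.
  rewrite relent_udiag// !retr_udiag//.
  rewrite (eq_bigr _ (fun (r : 'I_N) _ => congr1 (fun x => r%:R / N%:R ^+ 2 * x) (ZE r))).
  rewrite -sum_log_overlap//; apply: le_trans (lerD (lexx _) cN).
  rewrite /c mulr_suml -big_split; apply: ler_sum => i _.
  rewrite mulr_suml -big_split; apply: ler_sum => j _ /=.
  rewrite -mulrA -mulrDr ler_wpM2l ?overlap_ge0//.
  apply: le_trans (ler_wpM2l (ltW (t0 i)) (ln_le_sum R _ _ N (t0 i) (a0 j) N0)) _.
  rewrite mulrDr lerD2l le_eqVlt; apply/orP; left; apply/eqP.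
  by field; rewrite !lt0r_neq0.
move=> _ _ [U' [t' [Uu' t0' ->]]] [V' [a' [Vu' a0' ->]]].
rewrite relent_udiag// !retr_udiag//.
have le2 : \sum_(r < N) r%:R / N%:R ^+ 2 * quadratic (Z r) (r%:R / N%:R) (udiag U' t') (udiag V' a')
  <= \sum_(r < N) r%:R / N%:R ^+ 2 *
    \sum_i \sum_j overlap U' V' i j *
      ((t' i - a' j) ^+ 2 / ((1 - r%:R / N%:R) * t' i + r%:R / N%:R * a' j)).
  apply: ler_sum => r _; rewrite ler_wpM2l ?divr_ge0 ?sqr_ge0//.
  by apply: quadratic_le => // i j; exact: den.
apply: le_trans (lerD (lexx _) le2) _; rewrite -sum_log_overlap//.
apply: ler_sum => i _; apply: ler_sum => j _; rewrite ler_wpM2l ?overlap_ge0//.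
by rewrite ler_wpM2l ?sum_le_ln// ltW.
Qed.

End RelativeEntropy.

Local Open Scope classical_set_scope.
Local Open Scope ring_scope.
Local Open Scope complex_scope.
Local Open Scope sesquilinear_scope.

(** * Measurability of matrix functions *)

Section Measurability.
Import numFieldNormedType.Exports.
Context {d : measure_display} {T : measurableType d} {R : realType} {n : nat}.
Implicit Types X Y : T -> 'M[R[i]]_n.

Definition measurable_mx X := forall a b,
  measurable_fun setT (fun w => complex.Re (X w a b)) /\
  measurable_fun setT (fun w => complex.Im (X w a b)).

Lemma measurable_mx_cst (A : 'M[R[i]]_n) : measurable_mx (fun=> A).
Proof. by move=> a b; split; exact: measurable_cst. Qed.

Lemma measurable_mxD X Y : measurable_mx X -> measurable_mx Y ->
  measurable_mx (fun w => X w + Y w).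
Proof.
move=> mX mY a b; split.
  under eq_fun do rewrite mxE ReD.
  by apply: measurable_funD; [exact: (mX a b).1|exact: (mY a b).1].
under eq_fun do rewrite mxE ImD.
by apply: measurable_funD; [exact: (mX a b).2|exact: (mY a b).2].
Qed.

Lemma Re_mul (x y : R[i]) : complex.Re (x * y) =
  complex.Re x * complex.Re y - complex.Im x * complex.Im y.
Proof. by case: x; case: y. Qed.

Lemma Im_mul (x y : R[i]) : complex.Im (x * y) =
  complex.Re x * complex.Im y + complex.Im x * complex.Re y.
Proof. by case: x; case: y. Qed.

Lemma measurable_mxM X Y : measurable_mx X -> measurable_mx Y ->
  measurable_mx (fun w => X w *m Y w).
Proof.
move=> mX mY a b; split.
  under eq_fun do rewrite mxE Re_sum; apply: measurable_sum => j.
  under eq_fun do rewrite Re_mul.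
  by apply: measurable_funB; apply: measurable_funM;
    [exact: (mX a j).1|exact: (mY j b).1|exact: (mX a j).2|exact: (mY j b).2].
under eq_fun do rewrite mxE Im_sum; apply: measurable_sum => j.
under eq_fun do rewrite Im_mul.
by apply: measurable_funD; apply: measurable_funM;
  [exact: (mX a j).1|exact: (mY j b).2|exact: (mX a j).2|exact: (mY j b).1].
Qed.

Lemma measurable_mxZ (c : R) X : measurable_mx X -> measurable_mx (fun w => c%:C *: X w).
Proof.
move=> mX a b; split.
  under eq_fun do rewrite mxE ReZ.
  by apply: measurable_funM; [exact: measurable_cst|exact: (mX a b).1].
under eq_fun do rewrite mxE Im_mul /= mul0r addr0.
by apply: measurable_funM; [exact: measurable_cst|exact: (mX a b).2].
Qed.

Lemma measurable_mx_sum (I : Type) (s : seq I) (p : pred I) (X : I -> T -> 'M[R[i]]_n) :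
  (forall i, p i -> measurable_mx (X i)) -> measurable_mx (fun w => \sum_(i <- s | p i) X i w).
Proof.
move=> mX; elim: s => [|i s IH].
  by under eq_fun do rewrite big_nil; exact: measurable_mx_cst.
under eq_fun do rewrite big_cons.
have [pi|_] := boolP (p i); last exact: IH.
by apply: measurable_mxD => //; exact: mX.
Qed.

Lemma measurable_retr X : measurable_mx X -> measurable_fun setT (fun w => retr (X w)).
Proof.
move=> mX; rewrite /retr /mxtrace.
by under eq_fun do rewrite Re_sum; apply: measurable_sum => j; exact: (mX j j).1.
Qed.

Definition mxpow (A : 'M[R[i]]_n) k := iter k (mulmx A) 1%:M.

Definition expmx_series (A : 'M[R[i]]_n) N : 'M[R[i]]_n :=
  \sum_(k < N) (k`!%:R^-1)%:C *: mxpow A k.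

Lemma udiag1 (U : 'M[R[i]]_n) : U \is unitarymx -> udiag U (fun=> 1) = 1%:M.
Proof.
by move=> Uu; rewrite -(unitary_diag1 U Uu); congr unitary_diag; apply/rowP => j; rewrite !mxE.
Qed.

Lemma udiagM (U : 'M[R[i]]_n) a b : U \is unitarymx ->
  udiag U a *m udiag U b = udiag U (fun j => a j * b j).
Proof.
move=> Uu; apply: (etrans (unitary_diagM _ _ _ Uu)); congr unitary_diag.
by apply/rowP => j; rewrite !mxE -rmorphM.
Qed.

Lemma mxpow_udiag (U : 'M[R[i]]_n) a k : U \is unitarymx ->
  mxpow (udiag U a) k = udiag U (fun j => a j ^+ k).
Proof.
move=> Uu; elim: k => [|k IH]; first by apply/esym; exact: udiag1.
transitivity (udiag U a *m udiag U (fun j => a j ^+ k)); first by rewrite -IH.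
apply: (etrans (udiagM _ _ _ Uu)); congr udiag; apply/funext => j.
by rewrite exprS.
Qed.

Lemma expmx_series_udiag (U : 'M[R[i]]_n) a N : U \is unitarymx ->
  expmx_series (udiag U a) N = udiag U (fun j => series (exp_coeff (a j)) N).
Proof.
move=> Uu; apply/matrixP => p q; rewrite summxE udiagE.
under eq_bigr do rewrite mxpow_udiag// udiagZ udiagE.
rewrite exchange_big; apply: eq_bigr => j _; rewrite -mulr_suml; congr (_ * _).
rewrite -(rmorph_sum (real_complex R)); congr (_ %:C).
by rewrite /series/= big_mkord; apply: eq_bigr => l _; rewrite exp_coeffE.
Qed.

Lemma measurable_mxpow X k : measurable_mx X -> measurable_mx (fun w => mxpow (X w) k).
Proof.
move=> mX; elim: k => [|k IH]; first exact: measurable_mx_cst.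
exact: measurable_mxM.
Qed.

(** The spectral definition involves a choice of eigenbasis that need not be measurable. The
    exponential series avoids it: its partial sums are polynomials in the entries. *)
Lemma measurable_expmx X : measurable_mx X -> (forall w, X w \is hermsymmx) ->
  measurable_mx (fun w => expmx (X w)).
Proof.
move=> mX hX.
have mS N : measurable_mx (fun w => expmx_series (X w) N).
  by apply: measurable_mx_sum => l _; apply: measurable_mxZ; exact: measurable_mxpow.
(* [f] stands for the real or the imaginary part; real linearity is all that is used. *)
have cv (f : R[i] -> R) w a b :
    (forall c z, f (c%:C * z) = c * f z) ->
    (forall F : 'I_n -> R[i], f (\sum_j F j) = \sum_j f (F j)) ->
    f (expmx_series (X w) N a b) @[N --> \oo] --> f (expmx (X w) a b).
  move=> fZ fsum; have [U Uu XE] := herm_lambda _ (hX w).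
  rewrite XE /expmx specfun_udiag// udiagE fsum.
  under eq_fun do rewrite expmx_series_udiag// udiagE fsum.
  apply: cvg_big => [|j _]; first exact: add_continuous.
  under eq_fun do rewrite fZ; rewrite fZ.
  by apply: cvgMr_tmp; exact: is_cvg_series_exp_coeff.
move=> a b; split.
  apply: (measurable_fun_cvg (h := fun N w => complex.Re (expmx_series (X w) N a b))).
    by move=> N; exact: (mS N a b).1.
  move=> w _; apply: cv => [c z|F]; [exact: ReZ|exact: Re_sum].
apply: (measurable_fun_cvg (h := fun N w => complex.Im (expmx_series (X w) N a b))).
  by move=> N; exact: (mS N a b).2.
move=> w _; apply: cv => [c z|F]; [by rewrite Im_mul /= mul0r addr0|exact: Im_sum].
Qed.

(** Without the [j] largest eigenvalues, the trace of exp (N A) lies between exp (N lambda) and n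
    exp (N lambda) for the next one. This yields measurability of the eigenvalues one after the
    other. *)
Lemma cvg_lambda (A : 'M[R[i]]_n) j : A \is hermsymmx -> (j < n)%N ->
  N.+1%:R^-1 * ln (retr (expmx (N.+1%:R%:C *: A)) -
    \sum_(i < j) expR (N.+1%:R * lambda i.+1 A)) @[N --> \oo] --> lambda j.+1 A.
Proof.
move=> hA jn; pose Q N := retr (expmx (N.+1%:R%:C *: A)) - \sum_(i < j) expR (N.+1%:R * lambda i.+1 A).
under eq_fun do rewrite -/(Q _).
have QE N : Q N = \sum_(i < n | (j <= i)%N) expR (N.+1%:R * lambda i.+1 A).
  rewrite /Q retr_expmx ?hermZ//.
  under eq_bigr do rewrite lambdaZ// ?ltn_ord//.
  rewrite (bigID (fun i : 'I_n => (i < j)%N))/=.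
  rewrite -(big_ord_widen n (fun i => expR (N.+1%:R * lambda i.+1 A)) (ltnW jn)) addrAC subrr add0r.
  by apply: eq_bigl => i; rewrite -leqNgt.
have Q1 N : expR (N.+1%:R * lambda j.+1 A) <= Q N.
  rewrite QE (bigD1 (Ordinal jn))//= lerDl sumr_ge0// => i _; exact: expR_ge0.
have Q2 N : Q N <= n%:R * expR (N.+1%:R * lambda j.+1 A).
  rewrite QE; apply: (@le_trans _ _ (\sum_(i < n) expR (N.+1%:R * lambda j.+1 A))).
    rewrite [leLHS]big_mkcond; apply: ler_sum => i _; case: ifP => ji; last exact: expR_ge0.
    by rewrite ler_expR ler_wpM2l// lambda_mono// ji ltn_ord.
  by rewrite sumr_const card_ord [leRHS]mulr_natl.
have n0 : 0 < n%:R :> R by rewrite ltr0n (leq_ltn_trans _ jn).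
apply: (@squeeze_cvgr _ _ _ _ (fun=> lambda j.+1 A)
   (fun N => lambda j.+1 A + ln n%:R * harmonic N)).
- near=> N; have QN : 0 < Q N by apply: lt_le_trans (Q1 N); exact: expR_gt0.
  rewrite mulrC ler_pdivlMr// ler_pdivrMr//; apply/andP; split.
    by rewrite -ler_expR lnK// mulrC.
  rewrite mulrDl /= -mulrA mulVf ?mulr1// -ler_expR lnK//.
  by rewrite expRD lnK// [expR _ * _]mulrC mulrC [X in expR X]mulrC mulrC.
- exact: cvg_cst.
- rewrite -[X in _ --> X]addr0 -[X in _ --> _ + X](mulr0 (ln n%:R)).
  apply: cvgD; first exact: cvg_cst.
  by apply: cvgMl_tmp; exact: cvg_harmonic.
Unshelve. all: by end_near. Qed.

Lemma measurable_lambda X j : measurable_mx X -> (forall w, X w \is hermsymmx) ->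
  (j < n)%N -> measurable_fun setT (fun w => lambda j.+1 (X w)).
Proof.
move=> mX hX; have [k] := ubnP j; elim: k j => // k IH j jk jn.
apply: (measurable_fun_cvg (h := fun N w =>
  N.+1%:R^-1 * ln (retr (expmx (N.+1%:R%:C *: X w)) -
    \sum_(i < j) expR (N.+1%:R * lambda i.+1 (X w))))); last first.
  by move=> w _; exact: cvg_lambda.
move=> N; apply: measurable_funM; first exact: measurable_cst.
apply: measurableT_comp; first exact: measurable_ln.
apply: measurable_funB.
  apply: measurable_retr; apply: measurable_expmx => [|w]; last exact: hermZ.
  exact: measurable_mxZ.
apply: measurable_sum => i; apply: measurableT_comp; first exact: measurable_expR.
apply: measurable_funM; first exact: measurable_cst.
by apply: IH; [exact: leq_trans (ltn_ord i) jk|exact: ltn_trans jn].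
Qed.

Lemma measurable_topsum X r : measurable_mx X -> (forall w, X w \is hermsymmx) ->
  (r <= n)%N -> measurable_fun setT (fun w => topsum r (X w)).
Proof.
move=> mX hX rn; apply: measurable_sum => j; apply: measurable_lambda => //.
exact: leq_trans rn.
Qed.

End Measurability.

(** * Expectations and Lieb's concavity *)

Lemma addBA_cancel (V : zmodType) (a b c : V) : a + b - (b + c) = a - c.
Proof. by rewrite opprD addrA addrK. Qed.

Lemma subrDA_swap (V : zmodType) (a b c : V) : a - (b + c) = a - c - b.
Proof. by rewrite opprD addrA addrAC. Qed.

Section Expectation.
Context {d : measure_display} {T : measurableType d} {R : realType} {n : nat}.
Variable P : probability T R.
Implicit Types (X Y : T -> 'M[R[i]]_n) (f g : T -> R).

Lemma integrable_mx_measurable X : integrable_mx P X -> measurable_mx X.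
Proof.
by move=> iX a b; have [/measurable_int/measurable_EFinP mR /measurable_int/measurable_EFinP mI] :=
  iX a b.
Qed.

Lemma Re_expectation_mx X a b :
  complex.Re (expectation_mx P X a b) = \int[P]_w complex.Re (X w a b).
Proof. by rewrite mxE unlock. Qed.

Lemma Im_expectation_mx X a b :
  complex.Im (expectation_mx P X a b) = \int[P]_w complex.Im (X w a b).
Proof. by rewrite mxE unlock. Qed.

Lemma integrable_sum_EFin (I : Type) (s : seq I) (f : I -> T -> R) :
  (forall i, P.-integrable setT (EFin \o f i)) ->
  P.-integrable setT (EFin \o (fun w => \sum_(i <- s) f i w)).
Proof.
move=> fi; rewrite (_ : _ \o _ = fun w => (\sum_(i <- s) (f i w)%:E)%E); last first.
  by apply/funext => w; rewrite /= sumEFin.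
by apply: integrable_sum => // i _; exact: fi.
Qed.

Lemma Rintegral_sum (I : Type) (s : seq I) (f : I -> T -> R) :
  (forall i, P.-integrable setT (EFin \o f i)) ->
  \int[P]_w (\sum_(i <- s) f i w) = \sum_(i <- s) \int[P]_w f i w.
Proof.
move=> fi; elim: s => [|i s IH].
  by under eq_Rintegral do rewrite big_nil; rewrite big_nil /Rintegral integral0.
under eq_Rintegral do rewrite big_cons.
by rewrite big_cons -IH RintegralD//; exact: integrable_sum_EFin.
Qed.

Lemma integrable_EFinZl (c : R) f : P.-integrable setT (EFin \o f) ->
  P.-integrable setT (EFin \o (fun w => c * f w)).
Proof. by move=> fi; exact: (integrableZl measurableT c fi). Qed.

Lemma integrable_EFinB f g : P.-integrable setT (EFin \o f) -> P.-integrable setT (EFin \o g) ->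
  P.-integrable setT (EFin \o (fun w => f w - g w)).
Proof. by move=> fi gi; exact: (integrableB measurableT fi gi). Qed.

Lemma integrable_EFinD f g : P.-integrable setT (EFin \o f) -> P.-integrable setT (EFin \o g) ->
  P.-integrable setT (EFin \o (fun w => f w + g w)).
Proof. by move=> fi gi; exact: (integrableD measurableT fi gi). Qed.

Lemma retr_mulE (N M : 'M[R[i]]_n) : retr (N *m M) = \sum_p \sum_q
  (complex.Re (N p q) * complex.Re (M q p) - complex.Im (N p q) * complex.Im (M q p)).
Proof.
rewrite /retr Re_sum; apply: eq_bigr => p _; rewrite mxE Re_sum.
by apply: eq_bigr => q _; rewrite Re_mul.
Qed.

Let summand (N : 'M[R[i]]_n) X p q w := complex.Re (N p q) * complex.Re (X w q p) -
   complex.Im (N p q) * complex.Im (X w q p).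

Let integrable_summand N X p q : integrable_mx P X ->
  P.-integrable setT (EFin \o summand N X p q).
Proof.
by move=> iX; apply: integrable_EFinB; apply: integrable_EFinZl;
  [exact: (iX q p).1|exact: (iX q p).2].
Qed.

Lemma integrable_retr (N : 'M[R[i]]_n) X : integrable_mx P X ->
  P.-integrable setT (EFin \o (fun w => retr (N *m X w))).
Proof.
move=> iX; under [X in EFin \o X]eq_fun do rewrite retr_mulE.
by do 2![apply: integrable_sum_EFin => ?]; exact: integrable_summand.
Qed.

Lemma Rintegral_retr (N : 'M[R[i]]_n) X : integrable_mx P X ->
  \int[P]_w retr (N *m X w) = retr (N *m expectation_mx P X).
Proof.
move=> iX; under eq_Rintegral do rewrite retr_mulE.
rewrite retr_mulE (Rintegral_sum _ _ (fun p w => \sum_q summand N X p q w)); last first.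
  by move=> p; apply: integrable_sum_EFin => q; exact: integrable_summand.
apply: eq_bigr => p _; rewrite (Rintegral_sum _ _ (summand N X p)); last first.
  by move=> q; exact: integrable_summand.
apply: eq_bigr => q _; rewrite Re_expectation_mx Im_expectation_mx /summand.
rewrite RintegralB// ?RintegralZl//.
- exact: (iX q p).2.
- exact: (iX q p).1.
- apply: integrable_EFinZl; exact: (iX q p).1.
- apply: integrable_EFinZl; exact: (iX q p).2.
Qed.

Lemma herm_entries (A : 'M[R[i]]_n) : A \is hermsymmx <-> forall a b,
  complex.Re (A b a) = complex.Re (A a b) /\ - complex.Im (A b a) = complex.Im (A a b).
Proof.
have E a b : (A^t*) a b = (complex.Re (A b a) -i* complex.Im (A b a))%C.
  by rewrite mxE [X in _ X = _]mxE; case: (A b a).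
split=> [/hermP hA a b|hA].
  by rewrite -[in X in _ = X /\ _]hA -[in X in _ /\ _ = X]hA E.
apply/hermP/matrixP => a b; rewrite E; have [-> ->] := hA a b.
by case: (A a b).
Qed.

Lemma expectation_mx_herm X : integrable_mx P X -> (forall w, X w \is hermsymmx) ->
  expectation_mx P X \is hermsymmx.
Proof.
move=> iX hX; apply/herm_entries => a b.
rewrite !Re_expectation_mx !Im_expectation_mx; split.
  by apply: eq_Rintegral => w _; have /herm_entries/(_ a b)[] := hX w.
rewrite -mulN1r -RintegralZl//; last exact: (iX b a).2.
by apply: eq_Rintegral => w _; have /herm_entries/(_ a b)[_] := hX w; rewrite mulN1r.
Qed.

Lemma Rintegral_gt0 f : P.-integrable setT (EFin \o f) -> (forall w, 0 < f w) ->
  0 < \int[P]_w f w.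
Proof.
move=> fi f0; rewrite lt_neqAle Rintegral_ge0 ?andbT => [|w _]; last exact: ltW.
apply/negP => /eqP f_eq0.
have : (\int[P]_w `|(EFin \o f) w| = 0)%E.
  transitivity (\int[P]_w (f w)%:E)%E.
    by apply: eq_integral => w _; rewrite /= gtr0_norm.
  by rewrite -[LHS]fineK ?integrable_fin_num// -[fine _]/(\int[P]_w f w) -f_eq0.
move=> /(ae_eq_integral_abs _ measurableT (measurable_int _ fi)) [N [mN PN sub]].
have NT : N = setT.
  by apply/seteqP; split=> // w _; apply: sub => /(_ I) /eqP; rewrite /= eqe gt_eqF.
by have := probability_setT P; rewrite -NT PN => /eqP; rewrite eqe eq_sym oner_eq0.
Qed.

(** The first factor is the projector on the j-th basis vector. A row of overlaps sums to 1, so some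
    overlap is nonzero. *)
Lemma retr_pd_overlap_gt0 V (A : 'M[R[i]]_n) j : V \is unitarymx -> pd A ->
  0 < retr (udiag V (fun i => (i == j)%:R) *m A).
Proof.
move=> Vu [U [t [Uu t0 ->]]]; rewrite retr_udiagM (bigD1 j)//= [X in _ + X]big1 ?addr0; last first.
  by move=> i /negbTE ->; rewrite big1// => l _; rewrite !mul0r.
rewrite eqxx.
have : \sum_l overlap V U j l != 0 by rewrite (sum_overlap V U j Vu Uu) oner_eq0.
apply: contra_neqT; rewrite -leNgt => le0.
have ge0 l : 0 <= 1 * t l * overlap V U j l.
  by rewrite !mulr_ge0 ?overlap_ge0// ltW.
have : \sum_l 1 * t l * overlap V U j l == 0.
  by rewrite eq_le le0 sumr_ge0.
rewrite psumr_eq0// => /allP E; rewrite big1// => l _.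
have := E l (mem_index_enum _); rewrite mul1r mulf_eq0 (gt_eqF (t0 l)) => /eqP; exact.
Qed.

Lemma pd_herm (A : 'M[R[i]]_n) : pd A -> A \is hermsymmx.
Proof. by move=> [U [t [_ _ ->]]]; exact: udiag_herm. Qed.

Lemma pd_udiag (U : 'M[R[i]]_n) a : U \is unitarymx -> (forall j, 0 < a j) -> pd (udiag U a).
Proof. by move=> Uu a0; exists U, a. Qed.

Lemma expmx_udiag (U : 'M[R[i]]_n) a : U \is unitarymx ->
  expmx (udiag U a) = udiag U (expR \o a).
Proof. exact: specfun_udiag. Qed.

Lemma pd_expmx (A : 'M[R[i]]_n) : A \is hermsymmx -> pd (expmx A).
Proof.
move=> /herm_lambda[U Uu ->]; rewrite (expmx_udiag U _ Uu).
by apply: pd_udiag => // j; exact: expR_gt0.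
Qed.

Lemma retr_delta_udiag (U : 'M[R[i]]_n) a j : U \is unitarymx ->
  retr (udiag U (fun i => (i == j)%:R) *m udiag U a) = a j.
Proof.
move=> Uu; rewrite retr_udiagM (bigD1 j)//= [X in _ + X]big1 ?addr0; last first.
  by move=> i /negbTE ->; rewrite big1// => q _; rewrite !mul0r.
rewrite (bigD1 j)//= eqxx mul1r /overlap (unitaryKl Uu) mxE eqxx [X in _ + X]big1 ?addr0.
  by rewrite /sqnorm /= expr1n expr0n addr0 mulr1.
by move=> i ij; rewrite mxE eq_sym (negbTE ij) /sqnorm /= expr0n addr0 mulr0.
Qed.

Lemma expectation_mx_pd X : integrable_mx P X -> (forall w, pd (X w)) ->
  pd (expectation_mx P X).
Proof.
move=> iX pX; have hE := expectation_mx_herm X iX (fun w => pd_herm _ (pX w)).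
have [U Uu XE] := herm_lambda _ hE; rewrite XE; apply: pd_udiag => // j.
set l := lambda _ _.
suff -> : l = \int[P]_w retr (udiag U (fun i => (i == j)%:R) *m X w).
  by apply: Rintegral_gt0 => [|w]; [exact: integrable_retr|exact: retr_pd_overlap_gt0].
by rewrite Rintegral_retr// XE retr_delta_udiag.
Qed.

Lemma lnmx_expmx (K : 'M[R[i]]_n) : K \is hermsymmx -> lnmx (expmx K) = K.
Proof.
move=> /herm_lambda[U Uu KE].
have E (a : 'I_n -> R) : lnmx (expmx (udiag U a)) = udiag U a.
  rewrite (expmx_udiag U a Uu).
  apply: (etrans (specfun_udiag (@ln R) U _ Uu)); congr udiag.
  by apply/funext => j; rewrite /= expRK.
by have := E (fun j => lambda j.+1 K); rewrite -KE.
Qed.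

Lemma udiag_cst (U V : 'M[R[i]]_n) (h : R) : U \is unitarymx -> V \is unitarymx ->
  udiag U (fun=> h) = udiag V (fun=> h).
Proof.
move=> Uu Vu.
have E (W : 'M[R[i]]_n) : W \is unitarymx -> udiag W (fun=> h) = h%:C *: 1%:M.
  by move=> Wu; rewrite -(udiag1 W Wu) udiagZ; congr udiag; apply/funext => j; rewrite mulr1.
by rewrite (E U Uu) (E V Vu).
Qed.

Lemma retr_pd_ge0 (A : 'M[R[i]]_n) : pd A -> 0 <= retr A.
Proof. by move=> [U [t [Uu t0 ->]]]; rewrite retr_udiag// sumr_ge0// => j _; exact: ltW. Qed.

(** Klein's inequality for exp (H + X) and exp (X + h), where h bounds every eigenvalue of [H]. It
    supplies the dominating function in [lieb_jensen]. *)
Lemma retr_expmxD_le (H X : 'M[R[i]]_n) : H \is hermsymmx -> X \is hermsymmx ->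
  retr (expmx (H + X)) <= expR (\sum_(j < n) `|lambda j.+1 H|) * retr (expmx X).
Proof.
move=> hH hX; set h : R := \sum_(j < n) _.
have [W Wu HE] := herm_lambda _ hH; have [V Vu XE] := herm_lambda _ hX.
have [U [t [Uu t0 TE]]] := pd_expmx _ (hermD _ _ hH hX).
pose y (j : 'I_n) := lambda j.+1 X + h.
have SE : udiag V y = X + udiag W (fun=> h).
  rewrite -(udiagD V (fun j => lambda j.+1 X) (fun=> h)) -XE.
  by rewrite (udiag_cst W V h Wu Vu).
have pS : pd (expmx (udiag V y)) by apply: pd_expmx; exact: udiag_herm.
have -> : expR h * retr (expmx X) = retr (expmx (udiag V y)).
  rewrite (retr_expmx X hX) (expmx_udiag V y Vu) (retr_udiag V _ Vu) mulr_sumr.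
  by apply: eq_bigr => j _; rewrite /= expRD mulrC.
rewrite -subr_le0; apply: le_trans (klein _ _ (pd_expmx _ (hermD _ _ hH hX)) pS) _.
rewrite /relent (lnmx_expmx _ (hermD _ _ hH hX)) (lnmx_expmx _ (udiag_herm V y)).
rewrite SE addBA_cancel [X in _ *m (X - _)]HE udiagN.
rewrite (udiagD W (fun j => lambda j.+1 H) (fun=> - h)) TE retr_udiagM.
apply: sumr_le0 => i _; apply: sumr_le0 => j _.
rewrite mulr_le0_ge0 ?overlap_ge0// mulr_ge0_le0 ?(ltW (t0 i))// subr_le0.
rewrite (le_trans (ler_norm _))// /h (bigD1 j)//= lerDl.
by apply: sumr_ge0 => l _.
Qed.

Lemma udiag_entry_le (U : 'M[R[i]]_n) t a b : U \is unitarymx -> (forall j, 0 <= t j) ->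
  `|complex.Re (udiag U t a b)| <= \sum_j t j /\ `|complex.Im (udiag U t a b)| <= \sum_j t j.
Proof.
move=> Uu t0; rewrite udiagE.
have U1 j p : sqnorm (U j p) <= 1.
  have := unitary_row_norm _ j Uu => /(congr1 (@complex.Re R)).
  rewrite Re_sum (bigD1 p)//= mulcJ /= => <-; rewrite lerDl.
  by apply: sumr_ge0 => q _; rewrite mulcJ sqnorm_ge0.
have z1 (z : R[i]) : sqnorm z <= 1 -> `|complex.Re z| <= 1 /\ `|complex.Im z| <= 1.
  have e (x : R) : x ^+ 2 <= 1 -> `|x| <= 1.
    by rewrite -(@expr_le1 _ 2 `|x|)// real_normK ?num_real.
  by move=> z1; split; apply: e; apply: le_trans z1; rewrite /sqnorm ?lerDl ?lerDr sqr_ge0.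
have Z j : sqnorm ((U j a)^* * U j b) <= 1.
  by rewrite sqnormM sqnormJ mulr_ile1// sqnorm_ge0.
split.
  rewrite Re_sum (le_trans (ler_norm_sum _ _ _))//; apply: ler_sum => j _.
  by rewrite ReZ normrM ger0_norm// ler_piMr//; have [] := z1 _ (Z j).
rewrite Im_sum (le_trans (ler_norm_sum _ _ _))//; apply: ler_sum => j _.
rewrite Im_mul /= mul0r addr0 normrM ger0_norm// ler_piMr//.
by have [] := z1 _ (Z j).
Qed.

Lemma pd_entry_le (A : 'M[R[i]]_n) a b : pd A ->
  `|complex.Re (A a b)| <= retr A /\ `|complex.Im (A a b)| <= retr A.
Proof.
move=> [U [t [Uu t0 ->]]]; rewrite retr_udiag//.
by apply: udiag_entry_le => // j; exact: ltW.
Qed.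

Lemma integrable_mx_dominated X (f : T -> R) : measurable_mx X ->
  P.-integrable setT (EFin \o f) ->
  (forall w a b, `|complex.Re (X w a b)| <= f w /\ `|complex.Im (X w a b)| <= f w) ->
  integrable_mx P X.
Proof.
move=> mX fi Xf a b.
split; apply: (le_integrable _ _ _ fi) => //.
- exact/measurable_EFinP/(mX a b).1.
- by move=> w _; rewrite /= lee_fin (le_trans (Xf w a b).1)// ler_norm.
- exact/measurable_EFinP/(mX a b).2.
- by move=> w _; rewrite /= lee_fin (le_trans (Xf w a b).2)// ler_norm.
Qed.

Lemma lnmx_herm (A : 'M[R[i]]_n) : pd A -> lnmx A \is hermsymmx.
Proof.
move=> [U [t [Uu _ ->]]]; rewrite /lnmx (specfun_udiag (@ln R) U t Uu).
exact: udiag_herm.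
Qed.

(** Jensen's inequality: the form supporting the entropy at the expectations is integrated, and its
    slack [e] is arbitrary. *)
Lemma relent_expectation_le (H : 'M[R[i]]_n) (S A : T -> 'M[R[i]]_n) :
  integrable_mx P S -> integrable_mx P A -> (forall w, pd (S w)) -> (forall w, pd (A w)) ->
  (forall w, relent (S w) (A w) <= retr (H *m S w)) ->
  relent (expectation_mx P S) (expectation_mx P A) <= retr (H *m expectation_mx P S).
Proof.
move=> iS iA pS pA le; apply/ler_addgt0Pr => e e0.
have ES M := Rintegral_retr M S iS; have EA M := Rintegral_retr M A iA.
have iS1 M := integrable_retr M S iS; have iA1 M := integrable_retr M A iA.
have pS' := expectation_mx_pd S iS pS; have pA' := expectation_mx_pd A iA pA.
move: (expectation_mx P S) ES pS' (expectation_mx P A) EA pA' => S' ES pS' A' EA pA'.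
have [f [M1 [M2 fE]] [fSA fle]] := relent_support S' A' e pS' pA' e0.
apply: le_trans fSA _; rewrite lerD2r fE -ES -EA -ES -(RintegralD measurableT (iS1 M1) (iA1 M2)).
apply: (le_Rintegral measurableT (integrable_EFinD _ _ (iS1 M1) (iA1 M2)) (iS1 H)) => w _.
by rewrite -fE (le_trans (fle _ _ (pS w) (pA w))).
Qed.

Lemma integral_retr X : integrable_mx P X ->
  (\int[P]_w (retr (X w))%:E = (retr (expectation_mx P X))%:E)%E.
Proof.
move=> iX; have := Rintegral_retr 1%:M X iX; have := integrable_retr 1%:M X iX.
move: (expectation_mx P X) => X'.
under eq_Rintegral do rewrite mul1mx.
under [X in EFin \o X]eq_fun do rewrite mul1mx.
by rewrite mul1mx => i1 <-; rewrite fineK//; exact: integrable_fin_num.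
Qed.

(** Relative to exp (H + ln A) the entropy of [S] is that relative to [A] minus tr (H S), hence
    nonpositive; Klein's inequality concludes. *)
Lemma retr_expmx_le (S A H : 'M[R[i]]_n) : pd S -> pd A -> H \is hermsymmx ->
  relent S A <= retr (H *m S) -> retr S <= retr (expmx (H + lnmx A)).
Proof.
move=> pS pA hH le; have hHA := hermD _ _ hH (lnmx_herm _ pA).
rewrite -subr_le0; apply: le_trans (klein _ _ pS (pd_expmx _ hHA)) _.
rewrite /relent (lnmx_expmx _ hHA) subrDA_swap mulmxBr retrB.
by rewrite [X in _ - X]retr_mulC subr_le0.
Qed.

(* Gibbs' variational principle turns the joint convexity of the relative
   entropy into the concavity of A |-> tr exp (H + ln A). *)
Lemma lieb_jensen (H : 'M[R[i]]_n) X : H \is hermsymmx -> (forall w, X w \is hermsymmx) ->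
  measurable_mx X -> integrable_mx P (fun w => expmx (X w)) ->
  (\int[P]_w (retr (expmx (H + X w)))%:E <=
   (retr (expmx (H + lnmx (expectation_mx P (fun w => expmx (X w))))))%:E)%E.
Proof.
move=> hH hX mX iA; have hHX w : H + X w \is hermsymmx by exact: hermD.
have pA w := pd_expmx _ (hX w); have pS w := pd_expmx _ (hHX w).
have mS : measurable_mx (fun w => expmx (H + X w)).
  by apply: measurable_expmx => //; apply: measurable_mxD => //; exact: measurable_mx_cst.
have irA := integrable_retr 1%:M _ iA.
have iS : integrable_mx P (fun w => expmx (H + X w)).
  apply: (integrable_mx_dominated _ _ mS
    (integrable_EFinZl (expR (\sum_(j < n) `|lambda j.+1 H|)) _ irA)) => w a b.
  have [Sre Sim] := pd_entry_le _ a b (pS w).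
  have := retr_expmxD_le _ _ hH (hX w); rewrite mul1mx.
  by split; [apply: le_trans Sre _|apply: le_trans Sim _].
rewrite (integral_retr _ iS) lee_fin; apply: retr_expmx_le hH _.
- exact: expectation_mx_pd.
- exact: expectation_mx_pd.
(* Equality holds pointwise: with S = exp (H + X) and A = exp X, the difference of the logarithms is
   [H]. *)
apply: relent_expectation_le iS iA pS pA _ => w.
by rewrite /relent (lnmx_expmx _ (hHX w)) (lnmx_expmx _ (hX w)) addrK retr_mulC.
Qed.

End Expectation.

(** * Independence *)

Section Independence.
Context {d : measure_display} {T : measurableType d} {R : realType}.
Variable P : probability T R.
Implicit Types G : set (set T).

Lemma sub_g_sigma_measurable G : G `<=` measurable -> <<s G >> `<=` measurable.
Proof. by move=> GM; apply: smallest_sub => //; exact: sigma_algebra_measurable. Qed.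

(** Both sides are finite measures in [A] that agree on the pi-system [G]. *)
Lemma indep_g_sigma_left G (B : set T) : G `<=` measurable -> setI_closed G -> G setT ->
  measurable B -> (forall A, G A -> P (A `&` B) = (P A * P B)%E) ->
  forall A, <<s G >> A -> P (A `&` B) = (P A * P B)%E.
Proof.
move=> GM GI GT mB GB A sA.
have PB0 : (0 <= fine (P B))%R by exact: fine_ge0.
have E C : mscale (NngNum PB0) P C = (P C * P B)%E.
  by rewrite /mscale /= fineK ?fin_num_measure// muleC.
rewrite -E -[LHS]/(mrestr P mB A).
apply: (g_sigma_algebra_measure_unique G GM (fun=> setT)) => //.
- by rewrite bigcup_const//; exists 0%N.
- by move=> C GC; rewrite [RHS]E -GB.
- move=> _; rewrite -[ltLHS]/(P (setT `&` B)) setTI.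
  by rewrite (le_lt_trans (probability_le1 P mB)) ?ltry.
Qed.

Lemma indep_g_sigma G1 G2 : G1 `<=` measurable -> setI_closed G1 -> G1 setT ->
  G2 `<=` measurable -> setI_closed G2 -> G2 setT ->
  (forall A B, G1 A -> G2 B -> P (A `&` B) = (P A * P B)%E) ->
  forall A B, <<s G1 >> A -> <<s G2 >> B -> P (A `&` B) = (P A * P B)%E.
Proof.
move=> M1 I1 T1 M2 I2 T2 AB A B sA sB; rewrite setIC muleC.
apply: (indep_g_sigma_left G2) => //; first exact: sub_g_sigma_measurable sA.
move=> C GC; rewrite setIC muleC.
by apply: (indep_g_sigma_left G1) => // [|D GD]; [exact: M2|exact: AB].
Qed.

(** The identity maps from [T] to its two coarser sigma-algebras are independent random variables,
    so their joint law is a product measure and Tonelli's theorem applies to [f] on the diagonal. *)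
Lemma indep_tonelli G1 G2
    (f : g_sigma_algebraType G1 * g_sigma_algebraType G2 -> \bar R) :
  G1 `<=` measurable -> G2 `<=` measurable ->
  (forall A B, <<s G1 >> A -> <<s G2 >> B -> P (A `&` B) = (P A * P B)%E) ->
  measurable_fun setT f -> (forall x, (0 <= f x)%E) ->
  measurable_fun setT (fun w : T => \int[P]_w' f (w, w'))%E /\
  (\int[P]_w f (w, w) = \int[P]_w \int[P]_w' f (w, w'))%E.
Proof.
move=> M1 M2 AB mf f0.
have mid G : G `<=` measurable -> measurable_fun setT (id : T -> g_sigma_algebraType G).
  by move=> GM _ A mA; rewrite setTI; exact: sub_g_sigma_measurable mA.
pose X1 : {RV P >-> g_sigma_algebraType G1} := mfun_Sub (mem_set (mid _ M1)).
pose X2 : {RV P >-> g_sigma_algebraType G2} := mfun_Sub (mem_set (mid _ M2)).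
pose X12 : {RV P >-> (g_sigma_algebraType G1 * g_sigma_algebraType G2)%type} :=
  mfun_Sub (mem_set (measurable_fun_pair (mid _ M1) (mid _ M2))).
have FE w : fubini_F (distribution P X2) f w = (\int[P]_w' f (w, w'))%E.
  by rewrite /fubini_F ge0_integral_distribution//; exact: measurableT_comp.
have mF := measurable_fun_fubini_tonelli_F (m2 := distribution P X2) f mf f0.
split.
  by under eq_fun do rewrite -FE; apply: (measurableT_comp mF (mid _ M1)).
rewrite -[LHS]/(\int[P]_w (f \o X12) w)%E -ge0_integral_distribution//.
rewrite (eq_measure_integral (distribution P X1 \x distribution P X2)%E); last first.
  by move=> A mA _; apply/esym/product_measure_unique.
rewrite fubini_tonelli1// ge0_integral_distribution//.
  by apply: eq_integral => w _; exact: FE.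
by move=> w; exact: integral_ge0.
Qed.

End Independence.

(** * Trace exponentials of sums of independent matrices *)

Section SumOfIndependent.
Context {d : measure_display} {T : measurableType d} {R : realType} {n m : nat}.
Variables (P : probability T R) (X : 'I_m -> T -> 'M[R[i]]_n).
Hypotheses (X_herm : forall i w, X i w \is hermsymmx)
  (X_meas : forall i, random_mx (X i)) (X_indep : independent_mx P X).

Lemma borel_mx_re a b (U : set R) : measurable U ->
  borel_mx [set A : 'M[R[i]]_n | U (complex.Re (A a b))].
Proof. by move=> mU; apply: sub_sigma_algebra; exists a, b, U; split=> //; left. Qed.

Lemma borel_mx_im a b (U : set R) : measurable U ->
  borel_mx [set A : 'M[R[i]]_n | U (complex.Im (A a b))].
Proof. by move=> mU; apply: sub_sigma_algebra; exists a, b, U; split=> //; right. Qed.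

Lemma borel_mxT : borel_mx [set: 'M[R[i]]_n].
Proof. by rewrite -setC0 -setTD; apply: sigma_algebraCD; exact: sigma_algebra0. Qed.

Lemma borel_mxI : setI_closed (@borel_mx R n).
Proof.
have /sigma_algebraP : forall B, @borel_mx R n B -> B `<=` setT by [].
by case=> + _ => /(_ (smallest_sigma_algebra _ _))[].
Qed.

Let past (j : nat) : {set 'I_m} := [set i : 'I_m | (i < j)%N]%SET.

(** Only rectangles are taken: they are stable under intersection, and the independence hypothesis
    speaks of them directly. *)
Definition past_events (j : nat) : set (set T) :=
  [set A | exists2 B : 'I_m -> set 'M[R[i]]_n, (forall i, borel_mx (B i)) &
    A = \bigcap_(i in [set i | i \in past j]) (X i @^-1` B i)].

Definition present_events (j : 'I_m) : set (set T) :=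
  [set A | exists2 B, borel_mx B & A = X j @^-1` B].

Lemma past_events_measurable j : past_events j `<=` measurable.
Proof.
move=> _ [B mB ->]; apply: fin_bigcap_measurable => [|i _]; first exact: finite_finset.
by apply: X_meas; exact: mB.
Qed.

Lemma past_eventsI j : setI_closed (past_events j).
Proof.
move=> _ _ [B mB ->] [C mC ->]; exists (fun i => B i `&` C i).
  by move=> i; exact: borel_mxI.
by rewrite -bigcapI.
Qed.

Lemma past_eventsT j : past_events j setT.
Proof.
exists (fun=> setT); first by move=> _; exact: borel_mxT.
by apply/seteqP; split.
Qed.

Lemma present_events_measurable j : present_events j `<=` measurable.
Proof. by move=> _ [B mB ->]; exact: X_meas. Qed.

Lemma present_eventsI j : setI_closed (present_events j).
Proof.
by move=> _ _ [B mB ->] [C mC ->]; exists (B `&` C) => //; exact: borel_mxI.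
Qed.

Lemma present_eventsT j : present_events j setT.
Proof. by exists setT => //; exact: borel_mxT. Qed.

Lemma past_present_indep (j : 'I_m) A B : <<s past_events j >> A -> <<s present_events j >> B ->
  P (A `&` B) = (P A * P B)%E.
Proof.
apply: indep_g_sigma; [exact: past_events_measurable|exact: past_eventsI|exact: past_eventsT|
  exact: present_events_measurable|exact: present_eventsI|exact: present_eventsT|].
move=> _ _ [C mC ->] [D mD ->].
(* One family for the past and for [j], as the index [j] is not in its own past. *)
pose E i := if i == j then D else C i.
have jpast : j \notin past j by rewrite inE ltnn.
have mE i : borel_mx (E i) by rewrite /E; case: ifP.
have -> : \bigcap_(i in [set i | i \in past j]) (X i @^-1` C i) =
    \bigcap_(i in [set i | i \in past j]) (X i @^-1` E i).
  apply: eq_bigcapr => i ij; rewrite /E ifN//.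
  by apply: contraNneq jpast => ij_eq; rewrite -{1}ij_eq.
have -> : X j @^-1` D = X j @^-1` E j by rewrite /E eqxx.
have -> : \bigcap_(i in [set i | i \in past j]) (X i @^-1` E i) `&` X j @^-1` E j =
    \bigcap_(i in [set i | i \in (j |: past j)%SET]) (X i @^-1` E i).
  apply/seteqP; split=> [w [wE wj] i /=|w wE].
    by rewrite in_setU1 => /orP[/eqP->//|]; exact: wE.
  split=> [i /= ij|]; last by apply: (wE j); rewrite /= setU11.
  by apply: wE; rewrite /= in_setU1 ij orbT.
by rewrite !X_indep// big_setU1//= muleC.
Qed.

Lemma past_measurable_mx (j : nat) (i : 'I_m) : (i < j)%N ->
  measurable_mx (X i : g_sigma_algebraType (past_events j) -> 'M[R[i]]_n).
Proof.
move=> ij.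
have E (B : set 'M[R[i]]_n) : borel_mx B -> past_events j (X i @^-1` B).
  move=> mB; exists (fun l => if l == i then B else setT).
    by move=> l; case: ifP => // _; exact: borel_mxT.
  apply/seteqP; split=> [w wB l /= _|w wB].
    by case: eqP => // ->.
  by have := wB i; rewrite /= eqxx; apply; rewrite inE.
by move=> a b; split=> _ U mU; rewrite setTI; apply: sub_sigma_algebra;
  [exact: (E _ (borel_mx_re a b U mU))|exact: (E _ (borel_mx_im a b U mU))].
Qed.

Lemma present_measurable_mx (j : 'I_m) :
  measurable_mx (X j : g_sigma_algebraType (present_events j) -> 'M[R[i]]_n).
Proof.
by move=> a b; split=> _ U mU; rewrite setTI; apply: sub_sigma_algebra;
  eexists; [exact: (borel_mx_re a b U mU)|by []|exact: (borel_mx_im a b U mU)|by []].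
Qed.

Lemma measurable_mx_comp d1 d2 (T1 : measurableType d1) (T2 : measurableType d2)
    (Z : T2 -> 'M[R[i]]_n) (g : T1 -> T2) :
  measurable_mx Z -> measurable_fun setT g -> measurable_mx (fun w => Z (g w)).
Proof.
move=> mZ mg a b; split.
  exact: (measurableT_comp (mZ a b).1 mg).
exact: (measurableT_comp (mZ a b).2 mg).
Qed.

Lemma random_mx_measurable i : measurable_mx (X i).
Proof.
by move=> a b; split=> _ U mU; rewrite setTI;
  [exact: (X_meas i _ (borel_mx_re a b U mU))|exact: (X_meas i _ (borel_mx_im a b U mU))].
Qed.

Lemma herm_sum (I : Type) (s : seq I) (p : pred I) (A : I -> 'M[R[i]]_n) :
  (forall i, A i \is hermsymmx) -> \sum_(i <- s | p i) A i \is hermsymmx.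
Proof.
move=> hA; elim: s => [|i s IH]; first by rewrite big_nil; apply/hermP; rewrite trmx0 map_mx0.
by rewrite big_cons; case: (p i); [exact: hermD (hA i) IH|exact: IH].
Qed.

Variables (theta : R) (L : 'M[R[i]]_n).
Hypotheses (expX_int : forall i, integrable_mx P (fun w => expmx (theta%:C *: X i w)))
  (L_herm : L \is hermsymmx).

Let eq_integral_le (f g : T -> \bar R) : f =1 g -> (\int[P]_w f w <= \int[P]_w g w)%E.
Proof. by move=> /funext ->. Qed.

Let cumulant i := lnmx (expectation_mx P (fun w => expmx (theta%:C *: X i w))).

Let cumulant_herm i : cumulant i \is hermsymmx.
Proof.
exact: (lnmx_herm _ (expectation_mx_pd P _ (expX_int i)
  (fun w => pd_expmx _ (hermZ theta _ (X_herm i w))))).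
Qed.

(** An interpolation from the deterministic sum of cumulants, at 0, to theta Y, at [m]. *)
Let hybrid (j : nat) w := \sum_(i < m) (if (i < j)%N then theta%:C *: X i w else cumulant i).

(* Independence lets one freeze the past and apply the concavity to the [j]-th
   matrix only. *)
Let hybrid_step (j : 'I_m) :
  (\int[P]_w (retr (expmx (L + hybrid j.+1 w)))%:E <=
   \int[P]_w (retr (expmx (L + hybrid j w)))%:E)%E.
Proof.
(* The part common to both hybrids; it depends on the past only, since the later summands are
   constant. *)
pose W w := L + \sum_(i < m | i != j) (if (i < j)%N then theta%:C *: X i w else cumulant i).
have hW w : W w \is hermsymmx.
  apply: hermD L_herm _; apply: herm_sum => i.
  by case: ifP => _; [exact: hermZ|exact: cumulant_herm].
have hZ w := hermZ theta _ (X_herm j w).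
have E1 w : L + hybrid j.+1 w = W w + theta%:C *: X j w.
  rewrite /hybrid (bigD1 j)//= ltnSn addrCA addrC; congr (_ + _ + _).
  by apply: eq_bigr => i ij; rewrite ltnS leq_eqVlt val_eqE (negbTE ij).
have E2 w : L + hybrid j w = W w + cumulant j.
  by rewrite /hybrid (bigD1 j)//= ltnn addrCA addrC.
pose phi (A : 'M[R[i]]_n) := (retr (expmx A))%:E.
have I1 := eq_integral_le _ _ (fun w => congr1 phi (E1 w)).
have I2 := eq_integral_le _ _ (fun w => congr1 phi (esym (E2 w))).
have mWpast : measurable_mx (W : g_sigma_algebraType (past_events j) -> 'M[R[i]]_n).
  apply: measurable_mxD; first exact: measurable_mx_cst.
  apply: measurable_mx_sum => i _; have [ij|ij] := ltnP i j; last exact: measurable_mx_cst.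
  by apply: measurable_mxZ; exact: past_measurable_mx.
have mW : measurable_mx W.
  apply: measurable_mxD; first exact: measurable_mx_cst.
  apply: measurable_mx_sum => i _; have [ij|ij] := ltnP i j; last exact: measurable_mx_cst.
  by apply: measurable_mxZ; exact: random_mx_measurable.
pose f (z : g_sigma_algebraType (past_events j) * g_sigma_algebraType (present_events j)) :=
  (retr (expmx (W z.1 + theta%:C *: X j z.2)))%:E.
have mf : measurable_fun setT f.
  apply/measurable_EFinP; apply: measurable_retr; apply: measurable_expmx.
    apply: measurable_mxD.
      by apply: measurable_mx_comp mWpast _; exact: measurable_fst.
    apply: measurable_mxZ.
    by apply: measurable_mx_comp (present_measurable_mx j) _; exact: measurable_snd.
  by move=> z; exact: (hermD _ _ (hW z.1) (hZ z.2)).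
have f0 z : (0 <= f z)%E.
  by rewrite lee_fin; exact: (retr_pd_ge0 _ (pd_expmx _ (hermD _ _ (hW z.1) (hZ z.2)))).
have [mF I3] := indep_tonelli P _ _ f (past_events_measurable j)
  (present_events_measurable j) (past_present_indep j) mf f0.
apply: le_trans I1 _; apply: le_trans I2; apply: (le_trans (y := \int[P]_w \int[P]_w' f (w, w'))%E).
  by rewrite -I3.
apply: (ge0_le_integral _ measurableT) => [| |  |w _].
- by move=> w _; apply: integral_ge0 => w' _; exact: f0.
- exact: mF.
- apply/measurable_EFinP; apply: measurable_retr; apply: measurable_expmx.
    exact: (measurable_mxD _ _ mW (measurable_mx_cst _)).
  by move=> w; exact: (hermD _ _ (hW w) (cumulant_herm j)).
have mZ := measurable_mxZ theta _ (random_mx_measurable j).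
exact: (lieb_jensen P (W w) _ (hW w) hZ mZ (expX_int j)).
Qed.

Lemma integral_retr_expmx_sum_le :
  (\int[P]_w (retr (expmx (L + theta%:C *: \sum_(i < m) X i w)))%:E <=
   (retr (expmx (L + \sum_(i < m) cumulant i)))%:E)%E.
Proof.
have E1 w : theta%:C *: \sum_(i < m) X i w = hybrid m w.
  by rewrite scaler_sumr; apply: eq_bigr => i _; rewrite ltn_ord.
have le_hybrid : forall j, (j <= m)%N -> (\int[P]_w (retr (expmx (L + hybrid j w)))%:E <=
   \int[P]_w (retr (expmx (L + hybrid 0 w)))%:E)%E.
  elim=> [_|j IH jm]; first exact: lexx.
  exact: le_trans (hybrid_step (Ordinal jm)) (IH (ltnW jm)).
pose phi (A : 'M[R[i]]_n) := (retr (expmx A))%:E.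
have I1 := eq_integral_le _ _ (fun w => congr1 (fun A => phi (L + A)) (E1 w)).
have E0 w : hybrid 0 w = \sum_(i < m) cumulant i by apply: eq_bigr.
have I0 := eq_integral_le _ _ (fun w => congr1 (fun A => phi (L + A)) (E0 w)).
have I2 (c : \bar R) : (\int[P]_w c <= c)%E.
  have := integral_cst P measurableT c.
  by rewrite [X in (_ * X)%E](probability_setT P) mule1 => ->.
apply: le_trans I1 _; apply: le_trans (le_hybrid m (leqnn m)) _.
exact: le_trans I0 (I2 _).
Qed.

End SumOfIndependent.

(** * Laplace transform bounds *)

Section TopSum.
Context {d : measure_display} {T : measurableType d} {R : realType} {n : nat}.
Variable P : probability T R.
Implicit Types (A U : 'M[R[i]]_n) (X Y : T -> 'M[R[i]]_n).

(** Ky Fan's functional as a trace against a projector, a form that commutes with expectations. *)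
Lemma sum_quadform_retr r U A : U \is unitarymx -> A \is hermsymmx ->
  \sum_(i < n | (i < r)%N) complex.Re ((U *m A *m U^t*) i i) =
  retr (udiag U (fun i => (i < r)%:R) *m A).
Proof.
move=> Uu /herm_lambda[V Vu AE]; rewrite AE retr_udiagM.
rewrite big_mkcond; apply: eq_bigr => i _; case: ifP => ir.
  by rewrite Re_udiag_quadform//; apply: eq_bigr => j _; rewrite mul1r.
by rewrite big1// => j _; rewrite !mul0r.
Qed.

Lemma retr_le_topsum r U A : (r <= n)%N -> U \is unitarymx -> A \is hermsymmx ->
  retr (udiag U (fun i => (i < r)%:R) *m A) <= topsum r A.
Proof. by move=> rn Uu hA; rewrite -sum_quadform_retr// kyfan_le. Qed.

Lemma topsum_retr_eq r A : (r <= n)%N -> A \is hermsymmx ->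
  exists2 U, U \is unitarymx & topsum r A = retr (udiag U (fun i => (i < r)%:R) *m A).
Proof.
move=> rn hA; have [U Uu /(_ _ rn) <-] := kyfan_eq _ hA; exists U => //.
by rewrite sum_quadform_retr.
Qed.

Lemma topsum_norm_le r A : (r <= n)%N -> A \is hermsymmx ->
  `|topsum r A| <= n%:R * \sum_p \sum_q (`|complex.Re (A q p)| + `|complex.Im (A q p)|).
Proof.
move=> rn hA; have [U Uu ->] := topsum_retr_eq r A rn hA.
have N1 := fun p q => udiag_entry_le U (fun i : 'I_n => (i < r)%:R) p q Uu (fun j => ler0n _ _).
have le_n : \sum_(i < n) (i < r)%:R <= n%:R :> R.
  rewrite -[leRHS]mulr1 mulr_natl -[n in leRHS]card_ord -sumr_const.
  by apply: ler_sum => i _; case: (_ < _)%N; rewrite ?ler01.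
rewrite retr_mulE (le_trans (ler_norm_sum _ _ _))// mulr_sumr; apply: ler_sum => p _.
rewrite (le_trans (ler_norm_sum _ _ _))// mulr_sumr; apply: ler_sum => q _.
rewrite (le_trans (ler_normB _ _))// mulrDr !normrM.
by apply: lerD; rewrite ler_wpM2r// (le_trans _ le_n)//; [exact: (N1 p q).1|exact: (N1 p q).2].
Qed.

Lemma integrable_topsum r X : (r <= n)%N -> (forall w, X w \is hermsymmx) ->
  integrable_mx P X -> P.-integrable setT (EFin \o (fun w => topsum r (X w))).
Proof.
move=> rn hX iX.
have ib : P.-integrable setT (EFin \o (fun w => n%:R *
    \sum_p \sum_q (`|complex.Re (X w q p)| + `|complex.Im (X w q p)|))).
  apply: integrable_EFinZl; do 2![apply: integrable_sum_EFin => ?].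
  by apply: integrable_EFinD; apply: integrable_norm; [exact: (iX _ _).1|exact: (iX _ _).2].
apply: (le_integrable _ _ _ ib) => //.
  by apply/measurable_EFinP; apply: measurable_topsum => //; exact: integrable_mx_measurable iX.
move=> w _; rewrite /= lee_fin (le_trans (topsum_norm_le r _ rn (hX w)))//.
exact: ler_norm.
Qed.

(** The projector optimal for the expectation is merely admissible for each [X w]. *)
Lemma topsum_expectation_le r X : (r <= n)%N -> (forall w, X w \is hermsymmx) ->
  integrable_mx P X -> topsum r (expectation_mx P X) <= \int[P]_w topsum r (X w).
Proof.
move=> rn hX iX.
have [U Uu ->] := topsum_retr_eq r _ rn (expectation_mx_herm P X iX hX).
rewrite -Rintegral_retr//; apply: le_Rintegral => //.
- exact: integrable_retr.
- exact: integrable_topsum.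
- by move=> w _; exact: retr_le_topsum.
Qed.

Lemma integrable_mxN X : integrable_mx P X -> integrable_mx P (fun w => - X w).
Proof.
move=> iX a b; split.
  under [X in EFin \o X]eq_fun do rewrite mxE ReN -mulN1r.
  by apply: integrable_EFinZl; exact: (iX a b).1.
have E w : complex.Im ((- X w) a b) = -1 * complex.Im (X w a b).
  by rewrite mxE mulN1r; case: (X w a b).
under [X in EFin \o X]eq_fun do rewrite E.
by apply: integrable_EFinZl; exact: (iX a b).2.
Qed.

Lemma expectation_mxN X : integrable_mx P X ->
  expectation_mx P (fun w => - X w) = - expectation_mx P X.
Proof.
move=> iX; apply/matrixP => a b; rewrite [RHS]mxE.
apply/eqP; rewrite eq_complex; apply/andP; split; apply/eqP.
  rewrite ReN !Re_expectation_mx -mulN1r -RintegralZl//; last exact: (iX a b).1.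
  by apply: eq_Rintegral => w _; rewrite mxE ReN mulN1r.
have E (z : R[i]) : complex.Im (- z) = - complex.Im z by case: z.
rewrite E !Im_expectation_mx -mulN1r -RintegralZl//; last exact: (iX a b).2.
by apply: eq_Rintegral => w _; rewrite mxE E mulN1r.
Qed.

Lemma integrable_mxD X Y : integrable_mx P X -> integrable_mx P Y ->
  integrable_mx P (fun w => X w + Y w).
Proof.
move=> iX iY a b; split.
  under [X in EFin \o X]eq_fun do rewrite mxE ReD.
  by apply: integrable_EFinD; [exact: (iX a b).1|exact: (iY a b).1].
under [X in EFin \o X]eq_fun do rewrite mxE ImD.
by apply: integrable_EFinD; [exact: (iX a b).2|exact: (iY a b).2].
Qed.

Lemma integrable_mx_sum (I : Type) (s : seq I) (X : I -> T -> 'M[R[i]]_n) :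
  (forall i, integrable_mx P (X i)) -> integrable_mx P (fun w => \sum_(i <- s) X i w).
Proof.
move=> iX; elim: s => [|i s IH].
  under [X in integrable_mx P X]eq_fun do rewrite big_nil.
  move=> a b; split; under [X in EFin \o X]eq_fun do rewrite mxE; exact: integrable0.
under [X in integrable_mx P X]eq_fun do rewrite big_cons.
exact: integrable_mxD.
Qed.

(** The left-hand side is the term of the first [k] indices; the others are nonnegative. *)
Lemma expR_topsum_le k A : (k <= n)%N -> A \is hermsymmx ->
  expR (topsum k A) <= elsym [set: 'I_n]%SET k (fun j => expR (lambda j.+1 A)).
Proof.
move=> kn hA; pose J := [set i : 'I_n | (i < k)%N]%SET.
have cJ : #|J| = k.
  rewrite -sum1_card (eq_bigl (fun i : 'I_n => (i < k)%N)); last by move=> i; rewrite inE.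
  by rewrite -(big_ord_widen n (fun=> 1%N) kn) sum1_card card_ord.
rewrite /elsym (bigD1 J)/=; last by rewrite finset.subsetT cJ eqxx.
rewrite /topsum (big_ord_widen n (fun j => lambda j.+1 A) kn) expR_sum.
rewrite [leLHS](eq_bigl (fun i => i \in J)) => [|i]; last by rewrite inE.
rewrite lerDl sumr_ge0// => S _; apply: prodr_ge0 => j _; exact: expR_ge0.
Qed.

End TopSum.

(** * Means and tails from the k-trace *)

Section Laplace.
Context {d : measure_display} {T : measurableType d} {R : realType} {n m : nat}.
Variables (P : probability T R) (X : 'I_m -> T -> 'M[R[i]]_n).
Hypotheses (X_herm : forall i w, X i w \is hermsymmx)
  (X_meas : forall i, random_mx (X i)) (X_indep : independent_mx P X).
Variables (theta : R) (k : nat).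
Hypotheses (expX_int : forall i, integrable_mx P (fun w => expmx (theta%:C *: X i w)))
  (hk : (0 < k <= n)%N).

Let Y w := \sum_(i < m) X i w.
Let K := \sum_(i < m) lnmx (expectation_mx P (fun w => expmx (theta%:C *: X i w))).
Let F := Tr k (expmx K).

Let Y_herm w : theta%:C *: Y w \is hermsymmx.
Proof. exact: (hermZ theta _ (herm_sum _ _ _ _ (fun i => X_herm i w))). Qed.

Let K_herm : K \is hermsymmx.
Proof.
apply: herm_sum => i.
exact: (lnmx_herm _ (expectation_mx_pd P _ (expX_int i)
  (fun w => pd_expmx _ (hermZ theta _ (X_herm i w))))).
Qed.

Lemma ktrace_gt0 : 0 < F.
Proof.
rewrite /F (Tr_expmx k K K_herm); apply: elsym_gt0 => [i|]; first exact: expR_gt0.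
by rewrite cardsT card_ord; case/andP: hk.
Qed.

(* The weights [c] of the supporting hyperplane of [elsym k `^ (1 / k)] at the
   eigenvalues of [exp K] turn the k-trace into an ordinary trace. *)
Lemma laplace_majorant : exists G : T -> R,
  [/\ measurable_fun setT G, forall w, 0 <= G w,
     forall w, expR (topsum k (theta%:C *: Y w) / k%:R) <= G w &
     (\int[P]_w (G w)%:E <= (F `^ (k%:R^-1))%:E)%E].
Proof.
have /andP[k0 kn] := hk; have kR : k%:R != 0 :> R by rewrite pnatr_eq0 -lt0n.
have F0 := ktrace_gt0.
have [V Vu KE] := herm_lambda _ K_herm.
pose mu (j : 'I_n) := expR (lambda j.+1 K).
have FE : F = elsym [set: 'I_n]%SET k mu by rewrite /F (Tr_expmx k K K_herm).
have kS : (0 < k <= #|[set: 'I_n]%SET|)%N by rewrite cardsT card_ord hk.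
have [a a0 [amu asupp]] := elsym_support R _ [set: 'I_n]%SET k mu (fun i => expR_gt0 _) kS.
have sumT (f : 'I_n -> R) : \sum_(i in [set: 'I_n]%SET) f i = \sum_i f i.
  by apply: eq_bigl => i; rewrite inE.
pose r := F `^ (k%:R^-1).
have r0 : 0 < r by exact: powR_gt0.
have rk : r ^+ k = F by rewrite -powR_mulrn ?powR_ge0// -powRrM mulVf// powRr1// ltW.
have c0 i : 0 < r * a i by rewrite mulr_gt0// a0// inE.
(* The factor r, the k-th root of [F], is absorbed into the weights. As [L] shares the eigenbasis of
   [K], the trace of exp (L + K) is r times the sum of a_i mu_i, that is, r. *)
pose l i := ln (r * a i); pose L := udiag V l.
have L_herm : L \is hermsymmx := udiag_herm V l.
have supp (x : 'I_n -> R) : (forall i, 0 < x i) ->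
    elsym [set: 'I_n]%SET k x <= (\sum_i expR (l i) * x i) ^+ k.
  move=> x0; apply: le_trans (asupp x x0) _; rewrite sumT -FE -rk -exprMn mulr_sumr.
  rewrite le_eqVlt; apply/orP; left; apply/eqP; congr (_ ^+ _).
  by apply: eq_bigr => i _; rewrite /l lnK ?posrE// mulrA.
pose G w := retr (expmx (L + theta%:C *: Y w)).
have hG w := hermD _ _ L_herm (Y_herm w).
have G0 w : 0 <= G w := retr_pd_ge0 _ (pd_expmx _ (hG w)).
exists G; split => //.
- apply: measurable_retr; apply: measurable_expmx hG.
  apply: measurable_mxD; first exact: measurable_mx_cst.
  apply: measurable_mxZ; apply: measurable_mx_sum => i _.
  exact: random_mx_measurable.
- move=> w; rewrite -(@ler_pXn2r _ k)// ?nnegrE ?expR_ge0//.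
  rewrite -expRM_natl mulrC divfK//.
  apply: le_trans (expR_topsum_le k _ kn (Y_herm w)) _.
  by have := elsym_exp_le k _ V l (Y_herm w) Vu supp; rewrite addrC.
apply: le_trans (integral_retr_expmx_sum_le P X X_herm X_meas X_indep theta L expX_int L_herm) _.
rewrite lee_fin -/K KE udiagD expmx_udiag// retr_udiag//.
rewrite (eq_bigr (fun i => r * (a i * mu i))) => [|i _]; last first.
  by rewrite /= expRD /l lnK ?posrE// mulrA.
by rewrite -mulr_sumr -sumT amu mulr1.
Qed.

(** Jensen's inequality for ln, by its tangent at r. The function [s] is abstract to cover both
    signs of [theta]. *)
Lemma laplace_expectation (s : T -> R) : P.-integrable setT (EFin \o s) ->
  (forall w, topsum k (theta%:C *: Y w) = theta * s w) ->
  theta * \int[P]_w s w <= ln F.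
Proof.
move=> is_ sE; have [G [mG G0 sG GF]] := laplace_majorant.
have /andP[k0 kn] := hk; have kR : 0 < k%:R :> R by rewrite ltr0n.
set r := F `^ (k%:R^-1) in GF; have r0 : 0 < r by apply: powR_gt0; exact: ktrace_gt0.
have iG : P.-integrable setT (EFin \o G).
  apply/integrableP; split; first exact/measurable_EFinP.
  rewrite (eq_integral (fun w => (G w)%:E)) ?(le_lt_trans GF) ?ltry// => w _.
  by rewrite /= ger0_norm.
have GF' : \int[P]_w G w <= r.
  by rewrite -lee_fin /Rintegral fineK//; exact: integrable_fin_num.
have lnr : ln r = ln F / k%:R by rewrite ln_powR mulrC.
have pw w : theta / k%:R * s w <= r^-1 * G w + (ln r - 1).
  have := expR_ge1Dx (topsum k (theta%:C *: Y w) / k%:R - ln r).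
  rewrite expRB lnK ?posrE// => le1.
  have le2 : expR (topsum k (theta%:C *: Y w) / k%:R) / r <= r^-1 * G w.
    by rewrite mulrC ler_pM2l ?invr_gt0.
  have := le_trans le1 le2; rewrite sE.
  rewrite (_ : theta / k%:R * s w = theta * s w / k%:R); last by rewrite mulrAC.
  by move=> ?; lra.
have i1 := integrable_EFinZl P (theta / k%:R) s is_.
have i2 := integrable_EFinZl P r^-1 G iG.
have i3 : P.-integrable setT (EFin \o (fun=> ln r - 1)).
  exact: finite_measure_integrable_cst.
have := le_Rintegral measurableT i1 (integrable_EFinD P _ _ i2 i3) (fun w _ => pw w).
rewrite (RintegralD measurableT i2 i3) !RintegralZl// Rintegral_cst//.
rewrite [X in _ + _ * X](congr1 fine (probability_setT P)) mulr1 => le1.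
have le2 : r^-1 * \int[P]_w G w <= 1 by rewrite mulrC ler_pdivrMr// mul1r.
have le3 : theta / k%:R * \int[P]_w s w <= ln F / k%:R by rewrite -lnr; lra.
by move: le3; rewrite mulrAC ler_pM2r ?invr_gt0.
Qed.

(** Markov's inequality for the majorant [G]; on [A] the product e G is at least 1. *)
Lemma laplace_tail (A : set T) (t : R) : measurable A ->
  (forall w, A w -> theta * t <= topsum k (theta%:C *: Y w)) ->
  (P A <= (expR (- (theta * t / k%:R)) * (F `^ (k%:R^-1)))%:E)%E.
Proof.
move=> mA At; have [G [mG G0 sG GF]] := laplace_majorant.
have /andP[k0 kn] := hk; have kR : 0 < k%:R :> R by rewrite ltr0n.
set e := expR _; have e0 : 0 <= e by exact: expR_ge0.
rewrite EFinM; apply: le_trans (lee_wpmul2l _ GF); last by rewrite lee_fin.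
rewrite -ge0_integralZl//; last 2 first.
- exact/measurable_EFinP.
- by move=> w _; rewrite lee_fin.
rewrite -(setIT A) -(integral_indic P measurableT mA).
apply: ge0_le_integral => //.
- by apply/measurable_EFinP; exact: measurable_indic.
- by apply: measurable_funeM; exact/measurable_EFinP.
move=> w _; rewrite -EFinM lee_fin indicE; case: (boolP (w \in A)) => [wA|_]; last first.
  by rewrite mulr_ge0.
apply: le_trans (ler_wpM2l e0 (sG w)); rewrite -expRD /=.
rewrite -[leLHS]expR0 ler_expR addrC subr_ge0 ler_pM2r ?invr_gt0//.
by apply: At; rewrite inE in wA.
Qed.

End Laplace.

Local Close Scope sesquilinear_scope.

Theorem theorem2p2 (R : realType) (d : measure_display) (T : measurableType d)
    (P : probability T R) (n m : nat) (X : 'I_m -> T -> 'M[R[i]]_n)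
    (X_herm : forall i w, X i w \is hermsymmx)
    (X_meas : forall i, random_mx (X i))
    (X_indep : independent_mx P X)
    (X_int : forall i, integrable_mx P (X i))
    (expX_int : forall i (theta : R),
       integrable_mx P (fun w => expmx (theta%:C *: X i w)))
    (k : nat) (hk : (1 <= k <= n)%N) :
  let Y := fun w => \sum_(i < m) X i w in
  let F := fun theta : R =>
    Tr k (expmx (\sum_(i < m)
      lnmx (expectation_mx P (fun w => expmx (theta%:C *: X i w))))) in
  [/\ ((\sum_(1 <= j < k.+1) lambda j (expectation_mx P Y))%:E
         <= 'E_P[fun w => (\sum_(1 <= j < k.+1) lambda j (Y w))%R])%E /\
      ('E_P[fun w => (\sum_(1 <= j < k.+1) lambda j (Y w))%R]
         <= ereal_inf [set (theta^-1 * ln (F theta))%:E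
                      | theta in [set theta : R | (0 < theta)%R]])%E,
      ((\sum_(1 <= j < k.+1) lambda (n - j + 1) (expectation_mx P Y))%:E
         >= 'E_P[fun w => (\sum_(1 <= j < k.+1) lambda (n - j + 1) (Y w))%R])%E /\
      ('E_P[fun w => (\sum_(1 <= j < k.+1) lambda (n - j + 1) (Y w))%R]
         >= ereal_sup [set (theta^-1 * ln (F theta))%:E
                      | theta in [set theta : R | (theta < 0)%R]])%E,
      forall t : R,
        (P [set w | (\sum_(1 <= j < k.+1) lambda j (Y w) >= t)%R]
          <= ereal_inf
               [set (expR (- (theta * t / k%:R)) * (F theta `^ (k%:R^-1)))%:E
               | theta in [set theta : R | (0 < theta)%R]])%E
    & forall t : R,
        (P [set w | (\sum_(1 <= j < k.+1) lambda (n - j + 1) (Y w) <= t)%R]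
          <= ereal_inf
               [set (expR (- (theta * t / k%:R)) * (F theta `^ (k%:R^-1)))%:E
               | theta in [set theta : R | (theta < 0)%R]])%E ].

Proof.
have /andP[k0 kn] := hk; move=> Y F.
have hY w : Y w \is hermsymmx by apply: herm_sum => i; exact: X_herm.
have iY : integrable_mx P Y := integrable_mx_sum P _ _ _ X_int.
have hNY w : - Y w \is hermsymmx := hermN _ (hY w).
have iNY := integrable_mxN P _ iY.
have mNY := integrable_mx_measurable P _ iNY.
have mY := integrable_mx_measurable P _ iY.
have hEY := expectation_mx_herm P _ iY hY.
have topE (A : 'M[R[i]]_n) : \sum_(1 <= j < k.+1) lambda j A = topsum k A.
  by rewrite big_add1 big_mkord.
(* The index n - j + 1 for j from 1 is n - j for j from 0, as in [topsumN]. *)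
have botE (A : 'M[R[i]]_n) : A \is hermsymmx -> \sum_(1 <= j < k.+1) lambda (n - j + 1) A = - topsum k (- A).
  move=> hA; rewrite -topsumN// big_add1 big_mkord; apply: eq_bigr => j _.
  by rewrite addn1 subnSK// (leq_trans (ltn_ord j)).
pose top w := topsum k (Y w); pose bot w := - topsum k (- Y w).
have itop : P.-integrable setT (EFin \o top) := integrable_topsum P k Y kn hY iY.
have ibot : P.-integrable setT (EFin \o bot).
  have := integrable_EFinZl P (-1) _ (integrable_topsum P k _ kn hNY iNY).
  by under [X in EFin \o X]eq_fun do rewrite mulN1r.
have mtop : measurable_fun setT top by apply: measurable_topsum.
have mbot : measurable_fun setT bot.
  by apply: measurable_funN; apply: measurable_topsum.
have topF w : \sum_(1 <= j < k.+1) lambda j (Y w) = top w := topE _.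
have botF w : \sum_(1 <= j < k.+1) lambda (n - j + 1) (Y w) = bot w := botE _ (hY w).
have Etop : ('E_P[fun w => (\sum_(1 <= j < k.+1) lambda j (Y w))%R] = (\int[P]_w top w)%:E)%E.
  rewrite unlock /Rintegral fineK; last exact: integrable_fin_num.
  by apply: eq_integral => w _; rewrite topF.
have Ebot : ('E_P[fun w => (\sum_(1 <= j < k.+1) lambda (n - j + 1) (Y w))%R] =
    (\int[P]_w bot w)%:E)%E.
  rewrite unlock /Rintegral fineK; last exact: integrable_fin_num.
  by apply: eq_integral => w _; rewrite botF.
have topZ (theta : R) w : 0 < theta -> topsum k (theta%:C *: Y w) = theta * top w.
  by move=> t0; rewrite topsumZ// ltW.
(* For negative theta the largest eigenvalues of theta Y come from the smallest of Y. *)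
have botZ (theta : R) w : theta < 0 -> topsum k (theta%:C *: Y w) = theta * bot w.
  move=> t0; have -> : theta%:C *: Y w = (- theta)%:C *: (- Y w).
    by rewrite rmorphN scaleNr scalerN opprK.
  by rewrite topsumZ// ?oppr_ge0 1?ltW// /bot mulNr mulrN.
rewrite Etop Ebot; split.
- split.
    by rewrite topE lee_fin; exact: (topsum_expectation_le P k Y kn hY iY).
  apply: le_ereal_inf_tmp => _ [theta /= t0 <-]; rewrite lee_fin mulrC ler_pdivlMr// mulrC.
  exact: (laplace_expectation P X X_herm X_meas X_indep theta k (expX_int ^~ theta) hk top itop
    (fun w => topZ theta w t0)).
- split.
    rewrite (botE _ hEY) lee_fin -(expectation_mxN P Y iY).
    have := topsum_expectation_le P k _ kn hNY iNY.
    have -> : \int[P]_w bot w = - \int[P]_w topsum k (- Y w).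
      rewrite -mulN1r -RintegralZl//; last exact: integrable_topsum.
      by apply: eq_Rintegral => w _; rewrite mulN1r.
    by rewrite lerN2.
  apply: ge_ereal_sup => _ [theta /= t0 <-]; rewrite lee_fin mulrC ler_ndivrMr// mulrC.
  exact: (laplace_expectation P X X_herm X_meas X_indep theta k (expX_int ^~ theta) hk bot ibot
    (fun w => botZ theta w t0)).
- move=> t; under eq_set do rewrite topF.
  apply: le_ereal_inf_tmp => _ [theta /= t0 <-].
  apply: (laplace_tail P X X_herm X_meas X_indep theta k (expX_int ^~ theta) hk).
    by rewrite -[X in measurable X]setTI; exact: measurable_fun_le.
  by move=> w tw; rewrite topZ// ler_pM2l.
- move=> t; under eq_set do rewrite botF.
  apply: le_ereal_inf_tmp => _ [theta /= t0 <-].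
  apply: (laplace_tail P X X_herm X_meas X_indep theta k (expX_int ^~ theta) hk).
    by rewrite -[X in measurable X]setTI; exact: measurable_fun_le.
  by move=> w tw; rewrite botZ// ler_nM2l.
Qed.
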